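(* Let $\beta>-1$ and let $\bm\alpha=(\alpha_1,\dots,\alpha_r)$ satisfy $\alpha_1>\alpha_2>\cdots>\alpha_r>-1$ and $\alpha_i-\alpha_j\notin\mathbb Z$ for $i\neq j$. Assume that for a multi-index $\bm n=(n_1,\dots,n_r)\in\mathbb N^r$ and for a specific index $i\in\{1,\dots,r\}$, $$\alpha_1-1<\alpha_i<\min_{1\le j\le r}\{\alpha_j+n_j\}-n_i+1.$$ Then the Type I Jacobi–Piñeiro polynomial $P^{(\bm\alpha;\beta)}_{\bm n,i}$ belongs to $\mathbb P_{n_i-1}(\Delta_r)$, that is, all its zeros lie in $\Delta_r$. Additionally, for $0<t\le2$: (i) if $r$ is even, $P^{(\bm\alpha+t;\beta)}_{\bm n,i}\preccurlyeq P^{(\bm\alpha;\beta)}_{\bm n,i}$ and $P^{(\bm\alpha;\beta)}_{\bm n,i}\preccurlyeq P^{(\bm\alpha;\beta+t)}_{\bm n,i}$; (ii) if $r$ is odd, $P^{(\bm\alpha;\beta)}_{\bm n,i}\preccurlyeq P^{(\bm\alpha+t;\beta)}_{\bm n,i}$ and $P^{(\bm\alpha;\beta+t)}_{\bm n,i}\preccurlyeq P^{(\bm\alpha;\beta)}_{\bm n,i}$.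
   Context: $\mathbb N=\{1,2,\dots\}$, $|\bm n|=n_1+\dots+n_r$; $\bm\alpha+t=(\alpha_1+t,\dots,\alpha_r+t)$. Type I Jacobi–Piñeiro polynomials: $(P^{(\bm\alpha;\beta)}_{\bm n,1},\dots,P^{(\bm\alpha;\beta)}_{\bm n,r})$ is the (unique) vector of polynomials with $\deg P^{(\bm\alpha;\beta)}_{\bm n,j}\le n_j-1$ such that $Q(x)=\sum_{j=1}^rP^{(\bm\alpha;\beta)}_{\bm n,j}(x)x^{\alpha_j}(1-x)^\beta$ satisfies $\int_0^1Q(x)x^k\,dx=0$ for $0\le k\le|\bm n|-2$ and $\int_0^1Q(x)x^{|\bm n|-1}dx=1$. It is known that, up to a nonzero multiplicative constant, $$P^{(\bm\alpha;\beta)}_{\bm n,i}(x)\simeq{}_{r+1}F_r\left(-n_i+1,\ \alpha_i+\beta+|\bm n|,\ \alpha_i+1-\bm\alpha^{(i)}-\bm n^{(i)};\ \alpha_i+1,\ \alpha_i+1-\bm\alpha^{(i)};\ x\right),$$ where $\bm\alpha^{(i)},\bm n^{(i)}$ are obtained by deleting the $i$-th entry, scalars are added to each component, and ${}_{r+1}F_r$ denotes the standard (terminating) generalized hypergeometric series. Intervals: $\Delta_1=(0,1)$, and for $k\ge2$, $\Delta_k=(-\infty,0)$ if $k$ is even, $\Delta_k=(0,+\infty)$ if $k$ is odd. $\mathbb P_m(K)$ denotes polynomials of degree at most $m$ with all zeros in $K$. Interlacing: for real-rooted $p,q$ with zeros $\lambda_1(p)\le\dots\le\lambda_m(p)$ and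 $\lambda_1(q)\le\dots\le\lambda_m(q)$ of the same degree $m$, $p\preccurlyeq q$ means $\lambda_1(p)\le\lambda_1(q)\le\lambda_2(p)\le\lambda_2(q)\le\dots\le\lambda_m(p)\le\lambda_m(q)$. *)

(* Defs.v *)
From HB Require Import structures.
From mathcomp Require Import all_boot all_order all_algebra.
From mathcomp Require Import complex.
From mathcomp Require Import all_classical all_reals all_analysis.
Import Order.TTheory GRing.Theory Num.Theory.
Import numFieldNormedType.Exports.

Set Implicit Arguments.
Unset Strict Implicit.
Unset Printing Implicit Defensive.

Local Open Scope classical_set_scope.
Local Open Scope ring_scope.

Definition mi_norm (r : nat) (n : 'I_r -> nat) : nat := (\sum_(j < r) n j)%N.

Definition jp_form (R : realType) (r : nat) (alpha : 'I_r -> R) (beta : R)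
    (P : 'I_r -> {poly R}) (x : R) : R :=
  \sum_(j < r) (P j).[x] * x `^ (alpha j) * (1 - x) `^ beta.

Definition jp_moment (R : realType) (r : nat) (alpha : 'I_r -> R) (beta : R)
    (P : 'I_r -> {poly R}) (k : nat) : \bar R :=
  (\int[lebesgue_measure]_(x in `]0%R, 1%R[)
     (jp_form alpha beta P x * x ^+ k)%:E)%E.

Definition is_jp_typeI (R : realType) (r : nat) (alpha : 'I_r -> R) (beta : R)
    (n : 'I_r -> nat) (P : 'I_r -> {poly R}) : Prop :=
  [/\ forall j, (size (P j) <= n j)%N,
      forall k, (k.+1 < mi_norm n)%N -> jp_moment alpha beta P k = 0%E
    & jp_moment alpha beta P (mi_norm n).-1 = 1%E].

(* The i-th component of "the" type I vector, as a definite description: the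
   vector exists and is unique when alpha_j > -1, beta > -1, n_j >= 1 and the
   alpha_j are pairwise distinct modulo the integers; the zero vector is only
   the junk value of [xget] outside the range of existence. *)
Definition jp_typeI (R : realType) (r : nat) (alpha : 'I_r -> R) (beta : R)
    (n : 'I_r -> nat) : 'I_r -> {poly R} :=
  xget (fun _ => 0) [set P | is_jp_typeI alpha beta n P].

Definition shift_params (R : realType) (r : nat) (alpha : 'I_r -> R) (t : R)
    : 'I_r -> R :=
  fun j => alpha j + t.

Definition Delta {R : realType} (k : nat) : set R :=
  if k == 1%N then [set x | 0 < x < 1]
  else if odd k then [set x | 0 < x] else [set x | x < 0].

(* Zeros are taken in the complex numbers, so membership includes
   real-rootedness for K a set of reals, and excludes the zero polynomial. *)
Definition polys_zeros_in (R : realType) (m : nat) (K : set R) (p : {poly R})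
    : Prop :=
  (size p <= m.+1)%N /\
  forall z : R[i], root (map_poly (real_complex R) p) z ->
    exists2 x : R, K x & z = real_complex R x.

Definition ordered_zeros (R : realType) (p : {poly R}) (s : seq R) : Prop :=
  [/\ p != 0, sorted <=%R s
    & p = lead_coef p *: \prod_(x <- s) ('X - x%:P)].

Definition interlaces (R : realType) (p q : {poly R}) : Prop :=
  exists s t : seq R,
    [/\ ordered_zeros p s, ordered_zeros q t, size s = size t,
        forall k, (k < size s)%N -> s`_k <= t`_k
      & forall k, (k.+1 < size s)%N -> t`_k <= s`_k.+1].

(* Main.v *)
Require Import Defs.
From HB Require Import structures.
From mathcomp Require Import all_boot all_order all_algebra.
From mathcomp Require Import complex.
From mathcomp Require Import all_classical all_reals all_analysis.
From mathcomp Require Import measurable_realfun polyrcf polyorder ring lra zify.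
Import Order.TTheory GRing.Theory Num.Theory.
Import numFieldNormedType.Exports.
Local Open Scope ring_scope.

(** Up to a constant, [P_i (± x)] is obtained from the Jacobi polynomial
    [2F1(-N, c + d + N - 1; c; x)], with [N = n_i - 1], [c = alpha_i + 1] and
    [d = beta + |n| - n_i + 1], by applying for each [j <> i] the coefficient multiplier
    [1 / ((c_j)_k (d_j)_(N-k))], with [c_j = alpha_i - alpha_j + 1] and
    [d_j = alpha_j + n_j - n_i + 1 - alpha_i]; the hypotheses say that all [c_j], [d_j] are
    positive.
    This form of [P_i] comes from the residues of [1 / prod (s - alpha_j - m)]: against the
    functions [(1 - x)^k] the orthogonality conditions say that suitably weighted coefficients
    annihilate all polynomials of degree at most [|n| - 2] on the nodes [alpha_j + m].

    The multiplier [1 / (c)_k] is a limit of products of the operators [x d/dx + a], [a > 0], by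
    Gauss's product for the gamma function. Each of these preserves positive zeros, their
    interlacing, and their order; a larger [a] gives larger zeros. Reversing the coefficients gives
    [1 / (d)_(N-k)].
    The substitution [x = z / (1 + z)] turns the Jacobi polynomial itself into the image of
    [(1 - z)^N] under such a multiplier, which gives its zeros and their monotonicity in [c] and
    [d]. Interlacing for shifts [t <= 2] is then squeezed from the case [t = 2], which follows from
    the hypergeometric equation. *)

Set Implicit Arguments.
Unset Strict Implicit.
Unset Printing Implicit Defensive.

(** * Interlacing of simple positive zeros *)

Section RealRoots.
Variable R : rcfType.
Implicit Types (p q h : {poly R}) (s t u v : nat -> R) (N : nat) (a b c d x : R).

Definition prodX N s : {poly R} := \prod_(i < N) ('X - (s i)%:P).

Lemma horner_prodX N s x : (prodX N s).[x] = \prod_(i < N) (x - s i).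
Proof. by rewrite horner_prod; apply: eq_bigr => i _; rewrite hornerXsubC. Qed.

Lemma prodX_monic N s : prodX N s \is monic.
Proof. by apply: monic_prod => i _; exact: monicXsubC. Qed.

Lemma size_prodX N s : size (prodX N s) = N.+1.
Proof. by rewrite size_prod_XsubC -[RHS]/(N.+1) /index_enum -enumT size_enum_ord. Qed.

Lemma prodX_seq N s : prodX N s = \prod_(x <- mkseq s N) ('X - x%:P).
Proof. by rewrite /prodX -(big_mkord xpredT (fun i =>
    'X - (s i)%:P)) big_map /index_iota subn0. Qed.

Lemma deriv_prodX_root N s (k : 'I_N) :
  (prodX N s)^`().[s k] = \prod_(i < N | i != k) (s k - s i).
Proof.
rewrite /prodX (bigD1 k) //= derivM hornerD !hornerM derivXsubC hornerXsubC subrr.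
rewrite mul0r addr0 hornerC mul1r horner_prod.
by apply: eq_bigr => i _; rewrite hornerXsubC.
Qed.

Lemma deriv_prodX N s x : (forall i, (i < N)%N -> x != s i) ->
  (prodX N s)^`().[x] = (prodX N s).[x] * \sum_(i < N) (x - s i)^-1.
Proof.
elim: N => [|N IH] Hx.
  by rewrite /prodX !big_ord0 derivC hornerC mulr0.
have xN : x - s N != 0 by rewrite subr_eq0 Hx.
rewrite /prodX !big_ord_recr /= -/(prodX N s) derivM hornerD !hornerM derivXsubC.
rewrite hornerXsubC hornerC IH; last by move=> i iN; apply: Hx; exact: ltnW.
by field.
Qed.

Definition strict_pos N s :=
  (forall i, (i < N)%N -> 0 < s i) /\
  (forall i j, (i < j)%N -> (j < N)%N -> s i < s j).

(* IVT on each gap: consecutive values of [h] have opposite signs, because so do those of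
   [prodX N s] at 0 and of its derivative at the [s k]. *)
Lemma sign_interlace N s h (k0 : R) (k : nat -> R) : strict_pos N s ->
  (size h <= N.+1)%N -> 0 < k0 -> (forall i, (i < N)%N -> 0 < k i) ->
  h.[0] = k0 * (prodX N s).[0] ->
  (forall i, (i < N)%N -> h.[s i] = k i * (prodX N s)^`().[s i]) ->
  exists u, [/\ h = lead_coef h *: prodX N u,
    forall i, (i < N)%N -> 0 < u i,
    forall i, (i < N)%N -> u i < s i
    & forall i, (i.+1 < N)%N -> s i < u i.+1].
Proof.
move=> [s0 sl] sh k00 kp h0 hs.
(* [g i] is the left end of the i-th gap; the first gap starts at 0, where the sign is given by
   [h0]. *)
pose g i := if i is j.+1 then s j else 0.
have gs i : (i < N)%N -> g i < s i.
  by case: i => [|i] iN /=; [exact: s0 | exact: sl].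
have opp i : (i < N)%N -> h.[g i] * h.[s i] < 0.
  case: i => [|i] iN.
    rewrite /= h0 hs // horner_prodX.
    have -> : (prodX N s)^`().[s 0%N] = \prod_(j < N | j != Ordinal iN) (s 0%N - s j).
      by rewrite -(deriv_prodX_root s (Ordinal iN)).
    rewrite (bigD1 (Ordinal iN)) //= sub0r.
    set A := \prod_(_ < _ | _) _; set B := \prod_(_ < _ | _) _.
    have AB : 0 < A * B.
      rewrite /A /B -big_split /=; apply: prodr_gt0 => j jN.
      have j0 : (0 < j)%N by rewrite lt0n.
      rewrite nmulr_rgt0 ?subr_lt0; [exact: sl|].
      by rewrite s0.
    have := s0 _ iN; have := kp _ iN.
    set kk := k _; set ss := s _ => kk0 ss0.
    have := mulr_gt0 (mulr_gt0 (mulr_gt0 k00 kk0) ss0) AB; nra.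
  have iN' : (i < N)%N by apply: ltnW.
  rewrite /= !hs //.
  have -> : (prodX N s)^`().[s i] = \prod_(j < N | j != Ordinal iN') (s i - s j).
    by rewrite -(deriv_prodX_root s (Ordinal iN')).
  have -> : (prodX N s)^`().[s i.+1] = \prod_(j < N | j != Ordinal iN) (s i.+1 - s j).
    by rewrite -(deriv_prodX_root s (Ordinal iN)).
  (* Once s_i - s_(i+1) and its opposite are split off, the remaining factors agree in sign
     pairwise, since no zero lies strictly between s_i and s_(i+1). *)
  rewrite (bigD1 (Ordinal iN)) /=; last by rewrite -val_eqE /= neq_ltn ltnSn orbT.
  rewrite [X in _ * (_ * X) < 0](bigD1 (Ordinal iN')) /=; last first.
    by rewrite -val_eqE /= neq_ltn ltnSn.
  set A := \prod_(_ < _ | _) _; set B := \prod_(_ < _ | _) _.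
  have AB : 0 < A * B.
    have -> : B = \prod_(j < N | (j != Ordinal iN') && (j != Ordinal iN)) (s i.+1 - s j).
      by apply: eq_bigl => j; rewrite andbC.
    rewrite /A -big_split /=; apply: prodr_gt0 => j /andP[]; rewrite -!val_eqE /= => j1 j2.
    case: (ltngtP j i) j1 => // ji _.
      rewrite mulr_gt0 // subr_gt0 sl //; exact: ltnW.
    have ji' : (i.+1 < j)%N by rewrite ltn_neqAle eq_sym j2.
    by rewrite nmulr_rgt0 subr_lt0 sl.
  have := sl _ _ (ltnSn i) iN; have := kp _ iN; have := kp _ iN'.
  set kk := k _; set ll := k _; set ss := s _; set tt := s _ => kk0 ll0 st.
  have st' : 0 < tt - ss by rewrite subr_gt0.
  have := mulr_gt0 (mulr_gt0 (mulr_gt0 kk0 ll0) (mulr_gt0 st' st')) AB; nra.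
have /boolp.choice [u Hu] : forall i, exists x : R, (i < N)%N -> [/\ g i < x, x < s i & root h x].
  move=> i; case: (ltnP i N) => iN; last by exists 0.
  have [x] := poly_ivtoo (ltW (gs _ iN)) (opp _ iN).
  by rewrite in_itv /= => /andP[]; exists x.
have hn0 : h != 0.
  apply: contraTneq k00 => h00; move: h0; rewrite h00 horner0 => /esym/eqP.
  rewrite mulf_eq0 => /orP[/eqP->|]; first by rewrite ltxx.
  rewrite horner_prodX => /prodf_eq0 [i _]; rewrite sub0r oppr_eq0 => /eqP si.
  by have := s0 _ (ltn_ord i); rewrite si ltxx.
have ul i j : (i < j)%N -> (j < N)%N -> u i < u j.
  move=> ij jN; have iN := ltn_trans ij jN.
  have [_ ui _] := Hu _ iN; have [uj _ _] := Hu _ jN.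
  apply: (lt_le_trans ui); apply: le_trans (ltW uj).
  case: j ij jN {uj} => // j; rewrite ltnS leq_eqVlt => /orP[/eqP->|ij] jN //=.
  by apply/ltW/sl => //; exact: ltnW.
exists u; split.
- rewrite prodX_seq; apply: all_roots_prod_XsubC.
  + rewrite size_mkseq; apply/eqP; rewrite eqn_leq sh /=.
    have := @max_poly_roots _ h (mkseq u N) hn0; rewrite size_mkseq; apply.
      by apply/(all_nthP 0) => i; rewrite size_mkseq => iN; rewrite nth_mkseq //; case: (Hu i).
    apply/(uniqP 0) => i j; rewrite !inE size_mkseq => iN jN; rewrite !nth_mkseq // => e.
    by case: (ltngtP i j) => // ij; [move: (ul _ _ ij jN) | move: (ul _ _ ij iN)]; rewrite e ltxx.
  + by apply/(all_nthP 0) => i; rewrite size_mkseq => iN; rewrite nth_mkseq //; case: (Hu i).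
  + rewrite uniq_rootsE; apply/(uniqP 0) => i j; rewrite !inE size_mkseq => iN jN.
    rewrite !nth_mkseq // => e.
    by case: (ltngtP i j) => // ij; [move: (ul _ _ ij jN) | move: (ul _ _ ij iN)]; rewrite e ltxx.
- move=> i iN; have [ui _ _] := Hu _ iN; apply: le_lt_trans ui.
  by case: i iN => //= i iN; exact/ltW/s0/ltnW.
- by move=> i iN; case: (Hu _ iN).
- by move=> i iN; case: (Hu _ iN).
Qed.

Definition euler_op a p : {poly R} := 'X * p^`() + a *: p.

(** [sign_interlace] applies because the operator takes the value s_i p'(s_i) at each zero s_i of p,
    and a p(0) at 0. Dividing x p' + a p = 0 by p turns the logarithmic derivative into the equation
    for each new zero u_k; this equation makes the u_k comparable when s or a varies. *)
Lemma euler_op_roots N s a : strict_pos N s -> 0 < a ->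
  exists u, [/\ euler_op a (prodX N s) = lead_coef (euler_op a (prodX N s)) *: prodX N u,
    forall i, (i < N)%N -> 0 < u i < s i,
    forall i, (i.+1 < N)%N -> s i < u i.+1
    & forall k, (k < N)%N -> \sum_(i < N) (1 - s i / u k)^-1 = - a].
Proof.
move=> ss a0; have [s0 sl] := ss.
have sz : (size (euler_op a (prodX N s)) <= N.+1)%N.
  have pn : prodX N s != 0 by rewrite monic_neq0 // prodX_monic.
  rewrite (leq_trans (size_polyD _ _)) // geq_max (leq_trans (size_polyMleq _ _)) /=.
    by rewrite (leq_trans (size_scale_leq _ _)) ?size_prodX.
  by have := lt_size_deriv pn; rewrite size_polyX size_prodX.
have [] := @sign_interlace N s (euler_op a (prodX N s)) a s ss sz a0 s0.
- by rewrite /euler_op !hornerE ?mul0r ?add0r.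
- move=> i iN; rewrite /euler_op !hornerE horner_prodX.
  by rewrite (bigD1 (Ordinal iN)) //= subrr mul0r mulr0 addr0.
move=> u [hu u0 us su]; exists u; split=> //.
  by move=> i iN; rewrite u0 // us.
move=> k kN.
have uk0 : u k != 0 by rewrite gt_eqF // u0.
have ks i : (i < N)%N -> u k != s i.
  move=> iN; case: (ltnP i k) => ik.
    rewrite gt_eqF //; case: k ik kN {uk0} => // k; rewrite ltnS => ik kN.
    apply: le_lt_trans (su _ kN); move: ik; rewrite leq_eqVlt => /orP[/eqP->//|ik].
    by apply/ltW/sl => //; exact: ltnW.
  rewrite lt_eqF //; apply: (lt_le_trans (us _ kN)).
  by move: ik; rewrite leq_eqVlt => /orP[/eqP->//|ik]; apply/ltW/sl.
have : (euler_op a (prodX N s)).[u k] = 0.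
  by rewrite hu hornerZ horner_prodX (bigD1 (Ordinal kN)) //= subrr mul0r mulr0.
rewrite /euler_op !hornerE deriv_prodX //.
set P := (prodX N s).[_]; set S := \sum_(_ < _) _.
have -> : u k * (P * S) + a * P = P * (u k * S + a) by ring.
move/eqP; rewrite mulf_eq0 => /orP[|/eqP e].
  rewrite /P horner_prodX => /prodf_eq0 [i _].
  by rewrite subr_eq0 (negPf (ks i (ltn_ord i))).
have -> : - a = u k * S by lra.
rewrite /S mulr_sumr.
apply: eq_bigr => i _; have := ks i (ltn_ord i); rewrite -subr_eq0 => sn.
have -> : 1 - s i / u k = (u k - s i) / u k by field.
by rewrite invf_div.
Qed.

Lemma ltr_inv1B (x y : R) : x < y -> (y < 1) || (1 < x) -> (1 - x)^-1 < (1 - y)^-1.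
Proof.
move=> xy /orP[y1|x1].
  by rewrite ltf_pV2 ?posrE ?subr_gt0 ?(lt_trans xy) // ltrD2l ltrN2.
rewrite ltf_nV2 ?negrE ?subr_lt0 // ?ltrD2l ?ltrN2 //; exact: lt_trans xy.
Qed.

(** The function 1 / (1 - y) increases on each side of its pole y = 1; the last hypothesis keeps
    both ratios on the same side. *)
Lemma ratio_inv_lt (s1 t1 u1 v1 : R) : 0 < s1 -> 0 < u1 -> 0 < v1 -> s1 <= t1 -> v1 < u1 ->
  (t1 < v1) || (u1 < s1) -> (1 - s1 / u1)^-1 < (1 - t1 / v1)^-1.
Proof.
move=> s0 u0 v0 st vu H; apply: ltr_inv1B.
  rewrite ltr_pdivrMr // mulrAC ltr_pdivlMr //.
  have := ltr_pM2l s0 v1 u1; rewrite vu => /idP h1; apply: (lt_le_trans h1).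
  by rewrite ler_pM2r.
by rewrite ltr_pdivrMr // mul1r ltr_pdivlMr // mul1r.
Qed.

Lemma sumr_ltS N (F G : nat -> R) : (0 < N)%N -> (forall i, (i < N)%N -> F i < G i) ->
  \sum_(i < N) F i < \sum_(i < N) G i.
Proof.
case: N => // N _ H; elim: N H => [|N IH] H; first by rewrite !big_ord1 H.
rewrite !(big_ord_recr N.+1) /= ltrD ?H //; apply: IH => i iN; apply: H; exact: leq_trans iN _.
Qed.

Lemma strict_le N s i j : strict_pos N s -> (i <= j)%N -> (j < N)%N -> s i <= s j.
Proof. by move=> [_ sl]; rewrite leq_eqVlt => /orP[/eqP->//|ij] jN; apply/ltW/sl. Qed.

(** Were v_k < u_k, every term of the sum would be strictly larger for (t, v_k) than for (s, u_k),
    which would give -a < -b. *)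
Lemma euler_op_roots_le N s t u v a b : strict_pos N s -> strict_pos N t -> a <= b ->
  (forall i, (i < N)%N -> s i <= t i) ->
  (forall i, (i < N)%N -> 0 < u i < s i) -> (forall i, (i.+1 < N)%N -> s i < u i.+1) ->
  (forall i, (i < N)%N -> 0 < v i < t i) -> (forall i, (i.+1 < N)%N -> t i < v i.+1) ->
  (forall k, (k < N)%N -> \sum_(i < N) (1 - s i / u k)^-1 = - a) ->
  (forall k, (k < N)%N -> \sum_(i < N) (1 - t i / v k)^-1 = - b) ->
  forall k, (k < N)%N -> u k <= v k.
Proof.
move=> ss tt ab st us su vt tv eu ev k kN; rewrite leNgt; apply/negP => vu.
have /andP[u0 uks] := us _ kN; have /andP[v0 vkt] := vt _ kN.
have : \sum_(i < N) (1 - s i / u k)^-1 < \sum_(i < N) (1 - t i / v k)^-1.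
  apply: (@sumr_ltS N (fun i => (1 - s i / u k)^-1) (fun i => (1 - t i / v k)^-1)).
    exact: leq_ltn_trans kN.
  move=> i iN; apply: ratio_inv_lt => //; [by case: ss => + _; apply | exact: st |].
  case: (ltnP i k) => ik; apply/orP; [left | right].
    case: k ik kN {u0 uks v0 vkt vu} => // k; rewrite ltnS => ik kN.
    by apply: le_lt_trans (tv _ kN); apply: (strict_le tt ik); exact: ltnW.
  by apply: (lt_le_trans uks); exact: (strict_le ss ik).
by rewrite eu // ev // ltrN2 ltNge ab.
Qed.

(** Were u_(k+1) < v_k, pairing the term of t_i with that of s_(i+1) would make the sum at u_(k+1)
    exceed the sum at v_k, although both are -a. The unpaired terms, of s_0 and of the last t, are
    positive and negative and only widen the gap. *)
Lemma euler_op_roots_interlace N s t u v a : strict_pos N s -> strict_pos N t ->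
  (forall i, (i < N)%N -> s i <= t i) -> (forall i, (i.+1 < N)%N -> t i <= s i.+1) ->
  (forall i, (i < N)%N -> 0 < u i < s i) -> (forall i, (i.+1 < N)%N -> s i < u i.+1) ->
  (forall i, (i < N)%N -> 0 < v i < t i) -> (forall i, (i.+1 < N)%N -> t i < v i.+1) ->
  (forall k, (k < N)%N -> \sum_(i < N) (1 - s i / u k)^-1 = - a) ->
  (forall k, (k < N)%N -> \sum_(i < N) (1 - t i / v k)^-1 = - a) ->
  forall k, (k.+1 < N)%N -> v k <= u k.+1.
Proof.
move=> ss tt st ts us su vt tv eu ev k kN; rewrite leNgt; apply/negP => uv.
have kN' := ltnW kN.
have /andP[u0 uks] := us _ kN; have /andP[v0 vkt] := vt _ kN'.
have := ev _ kN'; have := eu _ kN.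
case: N ss tt st ts us su vt tv kN kN' {eu ev} => // N ss tt st ts us su vt tv kN kN'.
rewrite big_ord_recl big_ord_recr /= => eu ev.
have : \sum_(i < N) (1 - t i / v k)^-1 < \sum_(i < N) (1 - s (bump 0 i) / u k.+1)^-1.
  apply: (@sumr_ltS N (fun i => (1 - t i / v k)^-1) (fun i => (1 - s i.+1 / u k.+1)^-1)).
    by rewrite (leq_ltn_trans (leq0n k)).
  move=> i iN; apply: ratio_inv_lt => //; [by case: tt => + _; apply; exact: ltnW | exact: ts |].
  case: (ltnP i k) => ik; apply/orP; [left | right].
    by apply: le_lt_trans (su _ kN); apply: (strict_le ss _ kN').
  by apply: (lt_le_trans vkt); apply: (strict_le tt ik); exact: ltnW.
have : 0 < (1 - s 0%N / u k.+1)^-1.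
  rewrite invr_gt0 subr_gt0 ltr_pdivrMr // mul1r.
  by apply: le_lt_trans (su _ kN); apply: (strict_le ss (leq0n _) kN').
have : (1 - t N / v k)^-1 < 0.
  rewrite invr_lt0 subr_lt0 ltr_pdivlMr // mul1r.
  by apply: (lt_le_trans vkt); apply: (strict_le tt) => //; rewrite -ltnS.
move: eu ev; lra.
Qed.

End RealRoots.

(** * Limits of real-rooted polynomials *)

Section Interlacing.
Local Open Scope classical_set_scope.
Local Open Scope ring_scope.
Variable R : realType.
Implicit Types (p q h : {poly R}) (s t u v : nat -> R) (N : nat) (a b c d x : R).

(** Multiple zeros are allowed, unlike in [strict_pos], so that limits can be taken. *)
Definition pos_zeros N p s :=
  [/\ p != 0, p = lead_coef p *: prodX N s,
    forall i j, (i <= j)%N -> (j < N)%N -> s i <= s j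
    & forall i, (i < N)%N -> 0 < s i].

(** The flag [e] adds interlacing to the termwise order, so that both relations are carried through
    the same operations. *)
Definition zeros_le (e : bool) N p q := exists s t,
  [/\ pos_zeros N p s, pos_zeros N q t, forall i, (i < N)%N -> s i <= t i
    & e -> forall i, (i.+1 < N)%N -> t i <= s i.+1].

Lemma pos_zerosI N a p s : a != 0 -> p = a *: prodX N s ->
  (forall i j, (i <= j)%N -> (j < N)%N -> s i <= s j) ->
  (forall i, (i < N)%N -> 0 < s i) -> pos_zeros N p s.
Proof.
move=> a0 pE sl s0; split=> //.
  by rewrite pE scaler_eq0 (negPf a0) monic_neq0 // prodX_monic.
have -> : lead_coef p = a; last by [].
by rewrite pE lead_coefZ (monicP (prodX_monic _ _)) mulr1.
Qed.

(** Ultrafilters replace the extraction of subsequences: all sequences of zeros converge along one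
    and the same filter. *)
Lemma ultra_cvg (U : set_system nat) (f : nat -> R) (M : R) :
  UltraFilter U -> (\forall n \near U, `|f n| <= M) -> exists l : R, f @ U --> l.
Proof.
move=> UU fM.
have cpt : compact `[- M, M]%classic by exact: segment_compact.
have [|l [_ cl]] := cpt (f @ U) _.
  apply: filterS fM => n /=; rewrite in_itv /=; by rewrite ler_norml.
exists l => V lV.
have [//|nV] := in_ultra_setVsetC (f @^-1` V) UU.
by have [x [nVx Vx]] := cl (~` V) V nV lV.
Qed.

Lemma cvg_sum_ord (U : set_system nat) N (f : nat -> nat -> R) (l : nat -> R) : Filter U ->
  (forall i, (i < N)%N -> f i @ U --> l i) ->
  (fun n => \sum_(i < N) f i n) @ U --> \sum_(i < N) l i.
Proof.
move=> FU; elim: N => [|N IH] H.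
  by rewrite big_ord0; under eq_fun do rewrite big_ord0; exact: cvg_cst.
rewrite big_ord_recr; under eq_fun do rewrite big_ord_recr /=.
by apply: cvgD; [apply: IH => i iN; apply: H; exact: ltnW | exact: H].
Qed.

Lemma cvg_horner_prodX (U : set_system nat) N (S : nat -> nat -> R) s x : Filter U ->
  (forall i, (i < N)%N -> S ^~ i @ U --> s i) ->
  (fun n => (prodX N (S n)).[x]) @ U --> (prodX N s).[x].
Proof.
move=> FU; elim: N => [|N IH] H.
  by rewrite /prodX big_ord0; under eq_fun do rewrite big_ord0; exact: cvg_cst.
rewrite horner_prodX; under eq_fun do rewrite horner_prodX big_ord_recr /=.
rewrite big_ord_recr /=; apply: cvgM.
  rewrite -horner_prodX; under eq_fun do rewrite -horner_prodX.
  by apply: IH => i iN; apply: H; exact: ltnW.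
by apply: cvgB; [exact: cvg_cst | exact: H].
Qed.

(** Testing only at x > 1 keeps x and 1 - x away from 0 in the applications, where they are divided
    by. *)
Lemma poly_horner_inj p q : (forall x, 1 < x -> p.[x] = q.[x]) -> p = q.
Proof.
move=> pq; apply/eqP; rewrite -subr_eq0; apply/eqP.
apply: (@roots_geq_poly_eq0 _ _ [seq i.+2%:R | i <- iota 0 (size (p - q))]).
- by apply/allP => x /mapP[i _ ->]; rewrite rootE !hornerE pq ?subrr // ltr1n.
- rewrite map_inj_uniq ?iota_uniq // => i j /eqP.
  by rewrite eqr_nat => /eqP[].
- by rewrite size_map size_iota.
Qed.

(** Normalised by the coefficient of degree N, the polynomials become monic products that converge
    pointwise. Their zeros are bounded, hence converge along [U], and the limits multiply out to p
    up to its top coefficient; p(0) <> 0 keeps them positive. *)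
Lemma pos_zeros_lim (U : set_system nat) N (P : nat -> {poly R}) p (S : nat -> nat -> R) :
  UltraFilter U -> (forall n, pos_zeros N (P n) (S n)) ->
  (forall k, (fun n => (P n)`_k) @ U --> p`_k) -> (size p <= N.+1)%N ->
  p`_0 != 0 -> p`_N != 0 ->
  exists s, pos_zeros N p s /\ forall i, (i < N)%N -> S ^~ i @ U --> s i.
Proof.
move=> UU PS Pp sp p0 pN.
have PE n : P n = (P n)`_N *: prodX N (S n).
  have [_ e _ _] := PS n; rewrite {1}e; congr (_ *: _).
  rewrite e coefZ; have := monicP (prodX_monic N (S n)).
  by rewrite /lead_coef size_prodX => ->; rewrite mulr1 -e.
have Pn0 n : (P n)`_N != 0.
  have [+ _ _ _] := PS n; apply: contraNneq => e.
  by rewrite (PE n) e scale0r.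
have Phorner x : (fun n => (P n).[x]) @ U --> p.[x].
  have -> : p.[x] = \sum_(k < N.+1) p`_k * x ^+ k by rewrite (horner_coef_wide _ sp).
  have -> : (fun n => (P n).[x]) = (fun n => \sum_(k < N.+1) (P n)`_k * x ^+ k).
    apply/funext => n; apply: horner_coef_wide.
    by rewrite (PE n) (leq_trans (size_scale_leq _ _)) // size_prodX.
  apply: (@cvg_sum_ord U N.+1 (fun k n => (P n)`_k * x ^+ k) (fun k => p`_k * x ^+ k)) => k _.
  by apply: cvgM; [exact: Pp | exact: cvg_cst].
have prodcvg x : (fun n => (prodX N (S n)).[x]) @ U --> (p`_N)^-1 * p.[x].
  have -> : (fun n => (prodX N (S n)).[x]) = (fun n => ((P n)`_N)^-1 * (P n).[x]).
    by apply/funext => n; rewrite {2}(PE n) hornerZ mulrA mulVf // mul1r.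
  by apply: cvgM => //; apply: cvgV.
have [M HM] : exists M, \forall n \near U, `|(prodX N (S n)).[-1]| <= M.
  exists (`|(p`_N)^-1 * p.[-1]| + 1).
  have /cvgrPdist_lt /(_ 1 ltr01) := prodcvg (-1).
  apply: filterS => n; set A := (prodX _ _).[_]; set l := _ * _ => H.
  have -> : A = l - (l - A) by ring.
  by rewrite (le_trans (ler_normB _ _)) // lerD2l ltW.
(* All factors of the product at -1 have absolute value 1 + S_j >= 1, so the product dominates each
   zero. *)
have SM i n : (i < N)%N -> `|S n i| <= `|(prodX N (S n)).[-1]|.
  move=> iN; have [_ _ _ Sp] := PS n.
  rewrite horner_prodX normr_prod (bigD1 (Ordinal iN)) //=.
  rewrite -[X in X <= _]mulr1; apply: ler_pM => //.
    by have := Sp _ iN; move: (S n i) => y y0; rewrite (gtr0_norm y0) ltr0_norm; lra.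
  elim/big_ind: _ => // [x y|j _]; first by move=> *; apply: mulr_ege1.
  have := Sp _ (ltn_ord j); move: (S n j) => y y0; rewrite ltr0_norm; lra.
have /boolp.choice [s Hs] : forall i, exists l : R, (i < N)%N -> S ^~ i @ U --> l.
  move=> i; case: (ltnP i N) => iN; last by exists 0.
  have [|l Hl] := @ultra_cvg U (S ^~ i) M UU _; last by exists l.
  by apply: filterS HM => n; apply: le_trans; exact: SM.
have pE : p = p`_N *: prodX N s.
  apply: poly_horner_inj => x _; rewrite hornerZ.
  have := cvg_unique _ (cvg_horner_prodX (x := x) _ Hs) (prodcvg x).
  move=> ->; first by rewrite mulrA mulfV // mul1r.
  by apply: norm_hausdorff.
exists s; split=> //; apply: (pos_zerosI pN pE).
  move=> i j ij jN; have iN := leq_ltn_trans ij jN.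
  apply: (ler_cvg_to (Hs _ iN) (Hs _ jN)).
  by near=> n; have [_ _ Sl _] := PS n; exact: Sl.
move=> i iN; rewrite lt_neqAle; apply/andP; split.
  apply: contraNneq p0 => si; rewrite -horner_coef0 pE hornerZ horner_prodX.
  by rewrite (bigD1 (Ordinal iN)) //= -si subrr mul0r mulr0.
apply: (cvgr_to_ge (Hs _ iN)).
by near=> n; have [_ _ _ Sp] := PS n; apply/ltW/Sp.
Unshelve. all: by end_near.
Qed.

Lemma zeros_le_lim e N (P Q : nat -> {poly R}) p q :
  (forall n, zeros_le e N (P n) (Q n)) ->
  (forall k, (fun n => (P n)`_k) @ \oo --> p`_k) ->
  (forall k, (fun n => (Q n)`_k) @ \oo --> q`_k) ->
  (size p <= N.+1)%N -> (size q <= N.+1)%N ->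
  p`_0 != 0 -> p`_N != 0 -> q`_0 != 0 -> q`_N != 0 -> zeros_le e N p q.
Proof.
move=> H Pp Qq sp sq p0 pN q0 qN.
(* The zeros of both sequences converge along the same ultrafilter, so that inequalities between
   them pass to the limit. *)
have [U [UU oU]] := @ultraFilterLemma nat \oo _.
have [S HS] := boolp.choice H; have [T HT] := boolp.choice HS.
have [|k|s [ps Ss]] := @pos_zeros_lim U N P p S UU _ _ sp p0 pN.
- by move=> n; case: (HT n).
- exact: cvg_trans (cvg_app _ oU) (Pp k).
have [|k|t [qt Tt]] := @pos_zeros_lim U N Q q T UU _ _ sq q0 qN.
- by move=> n; case: (HT n).
- exact: cvg_trans (cvg_app _ oU) (Qq k).
exists s, t; split=> //.
  move=> i iN; apply: (ler_cvg_to (Ss _ iN) (Tt _ iN)).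
  by near=> n; have [_ _ + _] := HT n; apply.
move=> eT i iN; have iN' := ltnW iN.
apply: (ler_cvg_to (Tt _ iN') (Ss _ iN)).
by near=> n; have [_ _ _] := HT n; apply.
Unshelve. all: by end_near.
Qed.

End Interlacing.

(** * Coefficient multipliers *)

Section Multipliers.
Local Open Scope classical_set_scope.
Local Open Scope ring_scope.
Variable R : realType.
Implicit Types (e : bool) (p q h : {poly R}) (s t u v w : nat -> R) (N : nat) (a b c d x : R).

Lemma prodX_coefN N s : (prodX N s)`_N = 1.
Proof. by have := monicP (prodX_monic N s); rewrite /lead_coef size_prodX. Qed.

Lemma pos_zeros_size N p s : pos_zeros N p s -> size p = N.+1.
Proof.
by case=> p0 -> _ _; rewrite size_scale ?lead_coef_eq0 // size_prodX.
Qed.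

Lemma pos_zeros_coefN N p s : pos_zeros N p s -> p`_N != 0.
Proof.
by move=> H; have [+ _ _ _] := H; rewrite -lead_coef_eq0 /lead_coef (pos_zeros_size H).
Qed.

Lemma pos_zeros_coef0 N p s : pos_zeros N p s -> p`_0 != 0.
Proof.
move=> [p0 -> _ s0]; rewrite coefZ mulf_neq0 ?lead_coef_eq0 //.
rewrite -horner_coef0 horner_prodX; apply/prodf_neq0 => i _.
by rewrite sub0r oppr_eq0 gt_eqF // s0.
Qed.

Lemma pos_zerosZ N a p s : a != 0 -> pos_zeros N p s -> pos_zeros N (a *: p) s.
Proof.
move=> a0 [p0 pE sl s0]; apply: (@pos_zerosI _ _ (a * lead_coef p)) => //.
  by rewrite mulf_neq0 // lead_coef_eq0.
by rewrite {1}pE scalerA.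
Qed.

Lemma zeros_leZ e N a b p q : a != 0 -> b != 0 -> zeros_le e N p q ->
    zeros_le e N (a *: p) (b *: q).
Proof. by move=> a0 b0 [s [t [ps qt st ts]]]; exists s, t; split=> //; exact: pos_zerosZ. Qed.

Definition coef_mul N w p : {poly R} := \poly_(k < N.+1) (w k * p`_k).

Lemma coef_coef_mul N w p k : (size p <= N.+1)%N -> (coef_mul N w p)`_k = w k * p`_k.
Proof.
move=> sp; rewrite coef_poly; case: ltnP => // kN.
by rewrite [p`_k]nth_default ?mulr0 // (leq_trans sp).
Qed.

Lemma size_coef_mul N w p : (size (coef_mul N w p) <= N.+1)%N.
Proof. exact: size_poly. Qed.

Lemma eq_coef_mul N w1 w2 p : (forall k, (k <= N)%N -> w1 k = w2 k) ->
    coef_mul N w1 p = coef_mul N w2 p.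
Proof. by move=> H; apply/polyP => k; rewrite !coef_poly; case: ltnP => // kN; rewrite H. Qed.

Lemma coef_mul_comp N w1 w2 p : coef_mul N w1 (coef_mul N w2 p) =
    coef_mul N (fun k => w1 k * w2 k) p.
Proof.
by apply/polyP => k; rewrite !coef_poly; case: ltnP => // kN; rewrite mulrA.
Qed.

Lemma coef_mulZ N w a p : coef_mul N w (a *: p) = a *: coef_mul N w p.
Proof.
by apply/polyP => k; rewrite coefZ !coef_poly; case: ltnP => // _; rewrite ?mulr0 // coefZ mulrCA.
Qed.

Lemma coef_mul_euler N a p : (size p <= N.+1)%N -> coef_mul N (fun k => k%:R + a) p = euler_op a p.
Proof.
move=> sp; apply/polyP => k; rewrite coef_coef_mul // coefD coefXM coefZ mulrDl; congr (_ + _).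
by case: k => [|k] /=; [rewrite mul0r | rewrite coef_deriv mulr_natl].
Qed.

Lemma cvg_coef_prodX (U : set_system nat) N (S : nat -> nat -> R) s k : Filter U ->
  (forall i, (i < N)%N -> S ^~ i @ U --> s i) ->
  (fun n => (prodX N (S n))`_k) @ U --> (prodX N s)`_k.
Proof.
move=> FU; elim: N k => [|N IH] k H.
  by rewrite /prodX big_ord0; under eq_fun do rewrite big_ord0; exact: cvg_cst.
have E f : (prodX N.+1 f)`_k = (if k is j.+1 then (prodX N f)`_j else 0) - (prodX N f)`_k * f N.
  by rewrite /prodX big_ord_recr /= mulrBr coefB coefMX coefMC; case: k.
have IH' j : (fun n => (prodX N (S n))`_j) @ U --> (prodX N s)`_j.
  by apply: IH => i iN; apply: H; exact: ltnW.
rewrite E; under eq_fun do rewrite E.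
apply: cvgB; last by apply: cvgM => //; exact: H.
by case: (k) => [|j]; [exact: cvg_cst | exact: IH'].
Qed.

(** The comparison in [euler_op_roots_interlace] has one constant on both sides, whence the
    condition [e -> a = b]. *)
Lemma zeros_le_euler_strict e N s t a b : strict_pos N s -> strict_pos N t ->
  (forall i, (i < N)%N -> s i <= t i) -> (e -> forall i, (i.+1 < N)%N -> t i <= s i.+1) ->
  0 < a -> a <= b -> (e -> a = b) ->
  zeros_le e N (coef_mul N (fun k => k%:R + a) (prodX N s)) (coef_mul N (fun k =>
      k%:R + b) (prodX N t)).
Proof.
move=> ss tt st ts a0 ab eab; have b0 := lt_le_trans a0 ab.
rewrite !coef_mul_euler ?size_prodX //.
have [u [uE us su ue]] := euler_op_roots ss a0.
have [v [vE vt tv ve]] := euler_op_roots tt b0.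
have lc0 c f : 0 < c -> lead_coef (euler_op c (prodX N f)) != 0.
  move=> c0; rewrite lead_coef_eq0 -(@coef_mul_euler N) ?size_prodX //.
  apply/negP => /eqP /(congr1 (fun p => p`_N)); rewrite coef0 coef_coef_mul ?size_prodX //.
  by rewrite prodX_coefN mulr1 => /eqP; rewrite gt_eqF // ltr_wpDl.
have srt (f g : nat -> R) : strict_pos N f -> (forall i, (i < N)%N -> 0 < g i < f i) ->
    (forall i, (i.+1 < N)%N -> f i < g i.+1) ->
    forall i j, (i <= j)%N -> (j < N)%N -> g i <= g j.
  move=> ff gf fg i j; rewrite leq_eqVlt => /orP[/eqP->//|].
  case: j => // j; rewrite ltnS => ij jN.
  have /andP[_ h1] := gf _ (leq_ltn_trans ij (ltnW jN)).
  apply/ltW/(lt_trans h1)/(le_lt_trans _ (fg _ jN)).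
  by apply: (strict_le ff) => //; exact: ltnW.
exists u, v; split.
- apply: pos_zerosI (lc0 _ _ a0) uE _ _; first exact: srt us su.
  by move=> i iN; case/andP: (us _ iN).
- apply: pos_zerosI (lc0 _ _ b0) vE _ _; first exact: srt vt tv.
  by move=> i iN; case/andP: (vt _ iN).
- exact: (euler_op_roots_le ss tt ab st us su vt tv ue ve).
- move=> ee; move: vE ve; rewrite -(eab ee) => vE ve.
  exact: (euler_op_roots_interlace ss tt st (ts ee) us su vt tv ue ve).
Qed.

(* Multiple zeros are separated by the perturbation [s i + i / (n + 1)]. *)
Lemma zeros_le_euler e N p q a b : 0 < a -> a <= b -> (e -> a = b) -> zeros_le e N p q ->
  zeros_le e N (coef_mul N (fun k => k%:R + a) p) (coef_mul N (fun k => k%:R + b) q).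
Proof.
move=> a0 ab eab [s [t [ps qt st ts]]]; have b0 := lt_le_trans a0 ab.
have [p0 -> sl s0] := ps; have [q0 -> tl t0] := qt.
rewrite !coef_mulZ; apply: zeros_leZ; rewrite ?lead_coef_eq0 //.
pose pert (f : nat -> R) n i := f i + i%:R * n.+1%:R^-1.
have pertP f : (forall i j, (i <= j)%N -> (j < N)%N -> f i <= f j) ->
    (forall i, (i < N)%N -> 0 < f i) -> forall n, strict_pos N (pert f n).
  move=> fl f0 n; split=> [i iN | i j ij jN].
    by rewrite ltr_wpDr ?f0 // mulr_ge0 ?invr_ge0.
  by rewrite ler_ltD ?fl ?(ltnW ij) // ltr_pM2r ?invr_gt0 // ltr_nat.
have pertcvg f c k : (fun n => (coef_mul N (fun k => k%:R + c) (prodX N (pert f n)))`_k) @ \oo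
    --> (coef_mul N (fun k => k%:R + c) (prodX N f))`_k.
  rewrite coef_coef_mul ?size_prodX //; under eq_fun do rewrite coef_coef_mul ?size_prodX //.
  apply: cvgM; first exact: cvg_cst.
  apply: cvg_coef_prodX => i iN; rewrite -[X in _ --> X]addr0 -(mulr0 i%:R).
  by apply: cvgD; [exact: cvg_cst | apply: cvgM; [exact: cvg_cst | exact: cvg_harmonic]].
have c0 c f : 0 < c -> (forall i, (i < N)%N -> 0 < f i) ->
    (coef_mul N (fun k => k%:R + c) (prodX N f))`_0 != 0.
  move=> cp fp; rewrite coef_coef_mul ?size_prodX // add0r mulf_neq0 ?(gt_eqF cp) //.
  rewrite -horner_coef0 horner_prodX; apply/prodf_neq0 => i _.
  by rewrite sub0r oppr_eq0 gt_eqF // fp.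
have cN c f : 0 < c -> (coef_mul N (fun k => k%:R + c) (prodX N f))`_N != 0.
  by move=> cp; rewrite coef_coef_mul ?size_prodX // prodX_coefN mulr1 gt_eqF // ltr_wpDl.
apply: (@zeros_le_lim _ _ _ (fun n => coef_mul N (fun k => k%:R + a) (prodX N (pert s n)))
  (fun n => coef_mul N (fun k => k%:R + b) (prodX N (pert t n))));
      rewrite ?size_coef_mul ?c0 ?cN //.
move=> n; apply: zeros_le_euler_strict => //; [exact: pertP | exact: pertP | |].
  by move=> i iN; rewrite lerD2r st.
move=> ee i iN; rewrite lerD ?ts // ler_wpM2r ?invr_ge0 // ler_nat; exact: leqnSn.
Qed.

(** * Pochhammer symbols and the multipliers built from them *)

Definition poch a k : R := \prod_(j < k) (a + j%:R).

Lemma poch0 a : poch a 0 = 1. Proof. by rewrite /poch big_ord0. Qed.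

Lemma pochS a k : poch a k.+1 = poch a k * (a + k%:R).
Proof. by rewrite /poch big_ord_recr. Qed.

Lemma pochSl a k : poch a k.+1 = a * poch (a + 1) k.
Proof.
rewrite /poch big_ord_recl addr0; congr (_ * _); apply: eq_bigr => i _.
by rewrite lift0 -natr1 addrA addrAC.
Qed.

Lemma pochD a m n : poch a (m + n) = poch a m * poch (a + m%:R) n.
Proof.
elim: n => [|n IH]; first by rewrite addn0 poch0 mulr1.
by rewrite addnS !pochS IH natrD addrA mulrA.
Qed.

Lemma poch_gt0 a k : 0 < a -> 0 < poch a k.
Proof. by move=> a0; apply: prodr_gt0 => i _; rewrite ltr_wpDr. Qed.

Lemma poch_neq0 a k : 0 < a -> poch a k != 0.
Proof. by move=> a0; rewrite gt_eqF // poch_gt0. Qed.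

Lemma coef_mul_exp_horner N a p x : (size p <= N.+1)%N ->
    (coef_mul N (fun k => a ^+ k) p).[x] = p.[a * x].
Proof.
move=> sp; rewrite (horner_coef_wide _ (size_coef_mul _ _ _)) (horner_coef_wide _ sp).
by apply: eq_bigr => i _; rewrite coef_coef_mul // exprMn mulrAC mulrA mulrC mulrA.
Qed.

Lemma pos_zeros_dil N a p s : 0 < a -> pos_zeros N p s ->
  pos_zeros N (coef_mul N (fun k => a ^+ k) p) (fun i => s i / a).
Proof.
move=> a0 ps; have sp := pos_zeros_size ps; have [p0 pE sl s0] := ps.
apply: (@pos_zerosI _ _ (lead_coef p * a ^+ N)).
- by rewrite mulf_neq0 ?lead_coef_eq0 ?expf_neq0 // gt_eqF.
- apply: poly_horner_inj => x _; rewrite coef_mul_exp_horner ?sp // {1}pE !hornerZ -mulrA.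
  congr (_ * _); rewrite !horner_prodX -[in a ^+ N](card_ord N) -prodr_const -big_split /=.
  by apply: eq_bigr => i _; rewrite mulrBr mulrCA mulfV ?mulr1 // gt_eqF.
- by move=> i j ij jN; rewrite ler_pM2r ?invr_gt0 // sl.
- by move=> i iN; rewrite divr_gt0 // s0.
Qed.

Lemma zeros_le_dil e N a p q : 0 < a -> zeros_le e N p q ->
  zeros_le e N (coef_mul N (fun k => a ^+ k) p) (coef_mul N (fun k => a ^+ k) q).
Proof.
move=> a0 [s [t [ps qt st ts]]]; exists (fun i => s i / a), (fun i => t i / a).
split; [exact: pos_zeros_dil | exact: pos_zeros_dil | |] => [i iN | ee i iN];
  rewrite ler_pM2r ?invr_gt0 //; [exact: st | exact: ts].
Qed.

(** As a function of k, [poch (k%:R + a) n] is the multiplier of the composed Euler operators with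
    constants a, a + 1, ..., a + n - 1. *)
Lemma zeros_le_prod_euler e N n p q a b : 0 < a -> a <= b -> (e -> a = b) -> zeros_le e N p q ->
  zeros_le e N (coef_mul N (fun k => poch (k%:R + a) n) p) (coef_mul N (fun k =>
      poch (k%:R + b) n) q).
Proof.
move=> a0 ab eab pq; elim: n => [|n IH].
  have E c (r : {poly R}) : size r = N.+1 -> coef_mul N (fun k => poch (k%:R + c) 0) r = r.
    by move=> sr; apply/polyP => k; rewrite coef_coef_mul ?sr // poch0 mul1r.
  have [s [t [ps qt _ _]]] := pq.
  by rewrite !E // ?(pos_zeros_size ps) ?(pos_zeros_size qt).
have E c r : coef_mul N (fun k => poch (k%:R + c) n.+1) r =
    coef_mul N (fun k => k%:R + (c + n%:R)) (coef_mul N (fun k => poch (k%:R + c) n) r).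
  by rewrite coef_mul_comp; apply: eq_coef_mul => k _; rewrite pochS mulrC addrA.
rewrite !E; apply: zeros_le_euler => //; first by rewrite ltr_wpDr.
  by rewrite lerD2r.
by move=> /eab ->.
Qed.

(* Gauss's product: [1 / (c)_k] is the limit of [prod_(l < n) (c + l + k) / (c + l)] after the
   dilation [x -> x / (n + 1)]. *)
Lemma zeros_le_inv_poch e N p q c d : 0 < c -> c <= d -> (e -> c = d) -> zeros_le e N p q ->
  zeros_le e N (coef_mul N (fun k => (poch c k)^-1) p) (coef_mul N (fun k => (poch d k)^-1) q).
Proof.
move=> c0 cd ecd pq; have d0 := lt_le_trans c0 cd.
have [s [t [ps qt _ _]]] := pq.
pose W (a : R) n k := (poch a n)^-1 * ((n.+1%:R)^-1 ^+ k * poch (k%:R + a) n).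
have Wcvg a k : 0 < a -> (fun n => W a n k) @ \oo --> (poch a k)^-1.
  move=> a0; have -> : W a ^~ k = (fun n =>
      (poch a k)^-1 * \prod_(j < k) (1 + (a + j%:R - 1) * n.+1%:R^-1)).
    apply/funext => n; rewrite /W.
    (* Splitting (a)_(n+k) in two ways trades the n factors of (a + k)_n for the k factors of (a +
       n)_k; each of these, divided by n + 1, tends to 1. *)
    have := pochD a n k; rewrite addnC pochD [a + k%:R]addrC => E.
    have -> : poch (k%:R + a) n = poch a n * poch (a + n%:R) k / poch a k.
      by rewrite -E mulrC mulKf // poch_neq0.
    have F (l A B C : R) : A != 0 -> B != 0 -> A^-1 * (l * (A * C / B)) = B^-1 * (l * C).
      by move=> A0 B0; field; rewrite A0 B0.
    rewrite F ?poch_neq0 //; congr (_ * _); rewrite /poch.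
    rewrite -[in X in X * _](card_ord k) -prodr_const -big_split /=.
    apply: eq_bigr => j _; have : n.+1%:R != 0 :> R by rewrite pnatr_eq0.
    by rewrite -natr1 => n0; field.
  have step j : (fun n : nat => 1 + (a + j%:R - 1) * n.+1%:R^-1) @ \oo --> (1 : R).
    have := @cvgD _ R _ \oo _ _ _ 1 _ (cvg_cst _)
      (cvgM (cvg_cst (a + j%:R - 1)) (@cvg_harmonic R)).
    by rewrite mulr0 addr0; apply.
  have prodcvg : (fun n : nat => \prod_(j < k) (1 + (a + j%:R - 1) * n.+1%:R^-1)) @ \oo --> (1 : R).
    elim: (k) => [|m IH].
      by under eq_fun do rewrite big_ord0; exact: cvg_cst.
    under eq_fun do rewrite big_ord_recr /=.
    by have := cvgM IH (step m); rewrite mulr1; apply.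
  by have := cvgM (cvg_cst (poch a k)^-1) prodcvg; rewrite mulr1; apply.
have cv a (r : {poly R}) k : 0 < a -> size r = N.+1 ->
    (fun n => (coef_mul N (W a n) r)`_k) @ \oo --> (coef_mul N (fun k => (poch a k)^-1) r)`_k.
  move=> a0 sr; rewrite coef_coef_mul ?sr //; under eq_fun do rewrite coef_coef_mul ?sr //.
  by apply: cvgM; [exact: Wcvg | exact: cvg_cst].
have sp := pos_zeros_size ps; have sq := pos_zeros_size qt.
apply: (@zeros_le_lim _ _ _ (fun n => coef_mul N (W c n) p) (fun n => coef_mul N (W d n) q));
  rewrite ?size_coef_mul //; try by move=> k; apply: cv.
- move=> n; have E a (r : {poly R}) : coef_mul N (W a n) r =
      (poch a n)^-1 *: coef_mul N (fun k => n.+1%:R^-1 ^+ k) (coef_mul N (fun k =>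
          poch (k%:R + a) n) r).
    rewrite coef_mul_comp; apply/polyP => k; rewrite coefZ !coef_poly.
    by case: ltnP => _; rewrite ?mulr0 // /W !mulrA.
  rewrite !E; apply: zeros_leZ; rewrite ?invr_eq0 ?poch_neq0 //.
  by apply: zeros_le_dil; [rewrite invr_gt0 | exact: zeros_le_prod_euler].
all: rewrite coef_coef_mul ?sp ?sq // mulf_neq0 ?invr_eq0 ?poch_neq0 //.
- exact: pos_zeros_coef0 ps.
- exact: pos_zeros_coefN ps.
- exact: pos_zeros_coef0 qt.
- exact: pos_zeros_coefN qt.
Qed.

(** For p of degree at most N, the reciprocal polynomial x^N p(1/x). *)
Definition revp N p : {poly R} := \poly_(k < N.+1) p`_(N - k).

Lemma pos_zeros_revp N p s : pos_zeros N p s ->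
    pos_zeros N (revp N p) (fun i => (s (N - i.+1)%N)^-1).
Proof.
move=> ps; have sp := pos_zeros_size ps; have [p0 pE sl s0] := ps.
apply: (@pos_zerosI _ _ (lead_coef p * \prod_(i < N) (- s i))).
- rewrite mulf_neq0 ?lead_coef_eq0 //; apply/prodf_neq0 => i _.
  by rewrite oppr_eq0 gt_eqF // s0.
- apply: poly_horner_inj => x /(lt_trans ltr01) x0.
  have -> : (revp N p).[x] = x ^+ N * p.[x^-1].
    rewrite (horner_coef_wide _ (size_poly _ _)).
    have -> : p.[x^-1] = \sum_(i < N.+1) p`_i * x^-1 ^+ i by apply: horner_coef_wide; rewrite sp.
    rewrite mulr_sumr (reindex_inj rev_ord_inj) /=; apply: eq_bigr => i _.
    have iN : (i <= N)%N by rewrite -ltnS.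
    rewrite coef_poly subSS ltnS leq_subr subKn // mulrCA; congr (_ * _).
    have -> : x ^+ N = x ^+ (N - i) * x ^+ i by rewrite -exprD subnK.
    by rewrite exprVn mulfK // expf_neq0 // gt_eqF.
  rewrite {1}pE !hornerZ mulrCA -mulrA; congr (_ * _).
  rewrite !horner_prodX -[in x ^+ N](card_ord N) -prodr_const -big_split /=.
  rewrite [X in _ = _ * X](reindex_inj rev_ord_inj) -big_split /=; apply: eq_bigr => i _.
  have -> : (N - (N - i.+1).+1 = i)%N by have := ltn_ord i; lia.
  have := s0 _ (ltn_ord i); move: (s i) => y y0.
  by field; rewrite !gt_eqF.
- move=> i j ij jN; rewrite lef_pV2 ?posrE ?s0 //; last 2 first.
  + by have := jN; lia.
  + by have := jN; lia.
  by apply: sl; lia.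
- by move=> i iN; rewrite invr_gt0 s0 //; lia.
Qed.

Lemma zeros_le_revp e N p q : zeros_le e N p q -> zeros_le e N (revp N q) (revp N p).
Proof.
move=> [s [t [ps qt st ts]]].
exists (fun i => (t (N - i.+1)%N)^-1), (fun i => (s (N - i.+1)%N)^-1).
have [_ _ _ s0] := ps; have [_ _ _ t0] := qt.
split; [exact: pos_zeros_revp | exact: pos_zeros_revp | |].
  by move=> i iN; rewrite lef_pV2 ?posrE ?s0 ?t0 ?st //; lia.
move=> ee i iN; rewrite lef_pV2 ?posrE ?s0 ?t0 //; try lia.
have -> : (N - i.+1 = (N - i.+2).+1)%N by lia.
by apply: ts => //; lia.
Qed.

Definition poch_weight N c d k := (poch c k * poch d (N - k))^-1.

(** The factor 1 / (d)_(N-k) is 1 / (d)_k conjugated by reversal. The two reversals restore the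
    order of p and q, but the monotonicity in d has the opposite sense to that in c. *)
Lemma zeros_le_poch_weight e N p q c c' d d' : 0 < c -> c <= c' -> 0 < d' -> d' <= d ->
  (e -> c = c' /\ d = d') -> zeros_le e N p q ->
  zeros_le e N (coef_mul N (poch_weight N c d) p) (coef_mul N (poch_weight N c' d') q).
Proof.
move=> c0 cc d0 dd ecd pq.
have E a b (r : {poly R}) : size r = N.+1 -> coef_mul N (poch_weight N a b) r =
    coef_mul N (fun k => (poch a k)^-1) (revp N (coef_mul N (fun k => (poch b k)^-1) (revp N r))).
  move=> sr; apply/polyP => k; rewrite !coef_poly; case: ltnP => // kN.
  rewrite ltnS leq_subr subKn // /poch_weight invfM mulrA //.
have [s [t [ps qt _ _]]] := pq.
rewrite !E ?(pos_zeros_size ps) ?(pos_zeros_size qt) //.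
apply: zeros_le_inv_poch => //; first by move=> /ecd[].
apply: zeros_le_revp; apply: zeros_le_inv_poch => //; first by move=> /ecd[_ ->].
exact: zeros_le_revp.
Qed.

End Multipliers.

(** * The hypergeometric equation *)

Section HypergeometricEquation.
Local Open Scope classical_set_scope.
Local Open Scope ring_scope.
Variable R : realType.
Implicit Types (e : bool) (p q h g : {poly R}) (s t u v w : nat -> R) (N : nat) (a b c d x : R).

(** The sequences in [zeros_le] are existentially bound; uniqueness lets several such statements
    about one polynomial be chained. *)
Lemma pos_zeros_uniq N p s t : pos_zeros N p s -> pos_zeros N p t -> forall i, (i < N)%N ->
    s i = t i.
Proof.
move=> [p0 ps sl _] [_ pt tl _] i iN.
have st : mkseq s N = mkseq t N.
  apply: (@le_sorted_eq _ R).
  - apply/(sortedP 0) => k; rewrite size_mkseq => kN; rewrite !nth_mkseq ?(ltnW kN) //.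
    exact: sl.
  - apply/(sortedP 0) => k; rewrite size_mkseq => kN; rewrite !nth_mkseq ?(ltnW kN) //.
    exact: tl.
  apply: prod_XsubC_eq; rewrite -!prodX_seq.
  have := ps; rewrite {1}pt => /(scalerI _) -> //; by rewrite lead_coef_eq0.
by rewrite -(nth_mkseq 0 s iN) st nth_mkseq.
Qed.

(** The zeros u_i of q lie below the zeros t_i of r, so they inherit the bound t_i <= s_(i+1). *)
Lemma zeros_le_between N p q r : zeros_le true N p r -> zeros_le false N p q ->
    zeros_le false N q r -> zeros_le true N p q.
Proof.
move=> [s [t [ps rt _ /(_ isT) ts]]] [s' [u [ps' qu su _]]] [u' [t' [qu' rt' ut _]]].
exists s', u; split=> // _ i iN; have iN' := ltnW iN.
rewrite -(pos_zeros_uniq ps ps' iN) (pos_zeros_uniq qu qu' iN') (le_trans (ut _ iN')) //.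
by rewrite -(pos_zeros_uniq rt rt' iN') ts.
Qed.

(** If p had order m >= 2 at x, then [euler_op a p] would have order m - 1 and its derivative order
    m - 2. As x (1 + x) is nonzero there, the left side would have order m - 2, whereas the right
    side is divisible by (X - x)^(m-1). *)
Lemma mu_ode_le1 p x a (A B : {poly R}) : p != 0 -> 0 < x -> 0 < a ->
  'X * (1 + 'X) * (euler_op a p)^`() = A * euler_op a p + B * p -> (\mu_x p <= 1)%N.
Proof.
move=> p0 x0 a0; set g := euler_op a p => ode; rewrite leqNgt; apply/negP => m2.
have rp : root p x by rewrite -mu_gt0 // ltnW.
have mp' : \mu_x p^`() = (\mu_x p).-1 by rewrite mu_deriv // subn1.
have p'0 : p^`() != 0.
  by apply: contraTneq m2 => p'0; move: mp'; rewrite p'0 mu0 -leqNgt; lia.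
have Xp'0 : 'X * p^`() != 0 by rewrite mulf_neq0 ?polyX_eq0.
have mX : \mu_x 'X = 0%N by apply: muNroot; rewrite rootE hornerX gt_eqF.
have mg : \mu_x g = (\mu_x p).-1.
  have mXp' : \mu_x ('X * p^`()) = (\mu_x p).-1 by rewrite mu_mul // mX mp'.
  by rewrite /g /euler_op mu_addr // mXp' // mu_mulC ?gt_eqF //; lia.
have g0 : g != 0 by apply: contraTneq m2 => g0; move: mg; rewrite g0 mu0; lia.
have rg : root g x by rewrite -mu_gt0 // mg; lia.
have mg' : \mu_x g^`() = (\mu_x p).-2 by rewrite mu_deriv // mg; lia.
have g'0 : g^`() != 0.
  apply/negP => /eqP g'0; have := size_deriv g; rewrite g'0 size_poly0 => sg.
  have /size1_polyC gE : (size g <= 1)%N by move: sg; case: (size g) => [|[|k]].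
  by move: rg g0; rewrite gE rootE hornerC => /eqP ->; rewrite eqxx.
have X1 : root (1 + 'X) x = false.
  by apply/negbTE; rewrite rootE !hornerE gt_eqF // addr_gt0.
have X10 : 1 + 'X != 0 :> {poly R}.
  by apply/negP => /eqP e; move: X1; rewrite e root0.
have L0 : 'X * (1 + 'X) * g^`() != 0 by rewrite !mulf_neq0 ?polyX_eq0.
have : (('X - x%:P) ^+ (\mu_x p).-1 %| 'X * (1 + 'X) * g^`())%R.
  rewrite ode dvdp_add // dvdp_mull //; first by rewrite root_le_mu // mg.
  by rewrite root_le_mu // leq_pred.
rewrite root_le_mu // mu_mul // mu_mul ?mulf_neq0 ?polyX_eq0 // mX mg'.
by rewrite (muNroot (negbT X1)); case: (\mu_x p) m2 => [|[|k]] // _; rewrite /= ltnn.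
Qed.

Lemma pos_zeros_strict N p s : pos_zeros N p s ->
  (forall i, (i < N)%N -> (\mu_(s i) p <= 1)%N) -> strict_pos N s.
Proof.
move=> [p0 pE sl s0] mu1; split=> // i j ij jN; have iN := ltn_trans ij jN.
rewrite lt_neqAle sl ?(ltnW ij) // andbT; apply/negP => /eqP sij.
have := mu1 _ iN; rewrite leqNgt -root_le_mu // => /negP; apply.
rewrite pE dvdpZr ?lead_coef_eq0 // /prodX (bigD1 (Ordinal iN)) //= (bigD1 (Ordinal jN)) /=.
  by rewrite -sij mulrA expr2 dvdp_mulr.
by rewrite -val_eqE /= neq_ltn ij orbT.
Qed.

(* For a solution [p] of the hypergeometric equation (the hypothesis is its coefficient recursion),
   [h = (θ + c) (θ + c + 1) p] is a combination of [g = (θ + c + 1) p] and [p], with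
   [θ = x d/dx]: [(1 + x) h = (c + (2 c + 1 + N + b) x) g - D x p]; hence [h] has the sign of
   [p'] at each zero of [p]. *)
Lemma zeros_le_hypergeometric N p s c b : pos_zeros N p s -> 0 < c -> 0 < 1 + N%:R + b ->
  (forall k, (k.+1%:R) * (k.+1%:R + c + 1) * p`_k.+1 = - ((N%:R - k%:R) * (b - k%:R)) * p`_k) ->
  zeros_le true N (euler_op c (euler_op (c + 1) p)) p.
Proof.
move=> ps c0 b0 rec; have [p0 pE sl s0] := ps; have sp := pos_zeros_size ps.
set g := euler_op (c + 1) p; set h := euler_op c g.
(* [D] is the constant for which -(N - k)(b - k) = (c + 1 + N + b - k)(k + c + 1) - D for all k; the
   recursion then becomes a first-order relation between [g] and [p]. *)
pose D := (c + 1) * (c + 1 + N%:R + b) + N%:R * b.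
have ode : 'X * (1 + 'X) * g^`() = 'X * ((c + 1 + N%:R + b)%:P * g - D%:P * p).
  have cXd q k : ('X * q^`())`_k = k%:R * q`_k.
    by rewrite coefXM; case: k => [|k] /=; [rewrite mul0r | rewrite coef_deriv mulr_natl].
  have cg k : g`_k = (k%:R + (c + 1)) * p`_k by rewrite /g /euler_op coefD cXd coefZ -mulrDl.
  have -> : 'X * (1 + 'X) * g^`() = 'X * g^`() + 'X * ('X * g^`()) by ring.
  apply/polyP => k; rewrite coefD cXd coefXM [in RHS]coefXM.
  case: k => [|k] /=; first by rewrite mul0r addr0.
  rewrite coefB !coefCM cXd !cg; have := rec k; rewrite /D addrA.
  move: (k.+1%:R : R) (k%:R : R) (p`_k.+1) (p`_k) => k1 k0 y1 y0 H.
  by rewrite mulrA H; ring.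
have strict : strict_pos N s.
  apply: (pos_zeros_strict ps) => i iN.
  apply: (@mu_ode_le1 _ _ (c + 1) ('X * (c + 1 + N%:R + b)%:P) (- ('X * D%:P))) => //.
  - exact: s0.
  - by rewrite addr_gt0.
  - by rewrite ode -/g mulrBr !mulrA mulNr.
have hE x : (1 + x) * h.[x] = (c + (2 * c + 1 + N%:R + b) * x) * g.[x] - D * x * p.[x].
  have := congr1 (fun q => q.[x]) ode.
  rewrite /h /euler_op -/g !hornerE => H; lra.
have sg : (size g <= N.+1)%N.
  by rewrite /g -(@coef_mul_euler _ N) ?sp // size_coef_mul.
have sh : (size h <= N.+1)%N by rewrite /h -(@coef_mul_euler _ N) ?size_coef_mul.
have psi i : (i < N)%N -> p.[s i] = 0.
  move=> iN; rewrite pE hornerZ horner_prodX (bigD1 (Ordinal iN)) //=.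
  by rewrite subrr mul0r mulr0.
have lp : lead_coef p != 0 by rewrite lead_coef_eq0.
have prE : prodX N s = (lead_coef p)^-1 *: p.
  by apply: (scalerI lp); rewrite -pE scalerA mulfV // scale1r.
have [] := @sign_interlace R N s ((lead_coef p)^-1 *: h) (c * (c + 1))
    (fun i => (c + (2 * c + 1 + N%:R + b) * s i) / (1 + s i) * s i) strict.
- exact: leq_trans (size_scale_leq _ _) sh.
- by rewrite mulr_gt0 // addr_gt0.
- move=> i iN; have si0 := s0 _ iN.
  rewrite mulr_gt0 // divr_gt0 //; first by rewrite addr_gt0 // mulr_gt0 //; lra.
  by rewrite addr_gt0.
- have := hE 0; rewrite !mulr0 mul0r addr0 mul1r subr0 hornerZ => ->.
  by rewrite prE hornerZ /g /euler_op !(hornerD, hornerM, hornerX, hornerZ, hornerC); ring.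
- move=> i iN; have := hE (s i);
    rewrite psi // mulr0 subr0 /g /euler_op !(hornerD, hornerM, hornerX, hornerZ, hornerC) psi // => H.
  have si1 : 1 + s i != 0 by rewrite gt_eqF // addr_gt0 // s0.
  have -> : (prodX N s)^`().[s i] = (lead_coef p)^-1 * p^`().[s i].
    by rewrite prE derivZ hornerZ.
  apply: (mulfI si1); rewrite mulrCA H; field; by rewrite lp si1.
move=> u [hu u0 us su]; exists u, s; split=> //.
- have h0 : lead_coef h != 0.
    rewrite lead_coef_eq0; apply/negP => /eqP h0.
    have := hE 0;
        rewrite h0 /g /euler_op !(hornerD, hornerM, hornerX, hornerZ, hornerC) !(mulr0, mul0r) subr0 addr0 add0r => /esym/eqP.
    have p00 := pos_zeros_coef0 ps; rewrite horner_coef0.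
    by rewrite !mulf_eq0 (negPf p00) orbF gt_eqF //= gt_eqF // addr_gt0.
  apply: (pos_zerosI h0).
  + have lpV : (lead_coef p)^-1 != 0 by rewrite invr_eq0.
    by apply: (scalerI lpV); rewrite scalerA -lead_coefZ.
  + move=> i j; rewrite leq_eqVlt => /orP[/eqP->//|].
    case: j => // j; rewrite ltnS => ij jN.
    apply/ltW/(lt_trans (us _ (leq_ltn_trans ij (ltnW jN)))).
    by apply: (le_lt_trans _ (su _ jN)); apply: sl => //; exact: ltnW.
  + by [].
- by move=> i iN; apply/ltW/us.
- by move=> _ i iN; apply/ltW/su.
Qed.

End HypergeometricEquation.

(** * Jacobi polynomials *)

Section Jacobi.
Local Open Scope classical_set_scope.
Local Open Scope ring_scope.
Variable R : realType.
Implicit Types (e : bool) (p q h g : {poly R}) (s t u v w : nat -> R) (N : nat) (a b c d x : R).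

(** The expansion of (1 - x)^N, whose N zeros at 1 are the starting point for the multipliers. *)
Definition alt_bin N : {poly R} := \poly_(k < N.+1) ((-1) ^+ k * 'C(N, k)%:R).

Lemma alt_binE N : alt_bin N = (-1) ^+ N *: prodX N (fun=> 1).
Proof.
apply: poly_horner_inj => x _; rewrite (horner_coef_wide _ (size_poly _ _)) hornerZ horner_prodX.
rewrite prodr_const card_ord -exprMn mulN1r opprB exprBn.
by apply: eq_bigr => i _; rewrite coef_poly ltn_ord expr1n mulr1 -[RHS]mulr_natr mulrAC.
Qed.

Lemma zeros_le_alt_bin e N : zeros_le e N (alt_bin N) (alt_bin N).
Proof.
have H : pos_zeros N (alt_bin N) (fun=> 1).
  by apply: (pos_zerosI _ (alt_binE N)) => //; rewrite signr_eq0.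
by exists (fun=> 1), (fun=> 1).
Qed.

(* Up to a constant, [2F1(-N, -(d + N - 1); c; -z)]; the Jacobi polynomial is
   [(1 - x)^N K(x / (1 - x))] for this polynomial [K]. *)
Definition mjacobi N c d := coef_mul N (poch_weight N c d) (alt_bin N).

Lemma size_alt_bin N : (size (alt_bin N) <= N.+1)%N.
Proof. exact: size_poly. Qed.

Lemma coef_mjacobi N c d k : (k <= N)%N ->
  (mjacobi N c d)`_k = (-1) ^+ k * 'C(N, k)%:R / (poch c k * poch d (N - k)).
Proof. by move=> kN; rewrite coef_coef_mul ?size_alt_bin // coef_poly ltnS kN mulrC. Qed.

Lemma coef_mjacobi_gt N c d k : (N < k)%N -> (mjacobi N c d)`_k = 0.
Proof. by move=> kN; rewrite coef_poly ltnS leqNgt kN. Qed.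

Lemma zeros_le_mjacobi_le N c c' d : 0 < c -> c <= c' -> 0 < d ->
    zeros_le false N (mjacobi N c d) (mjacobi N c' d).
Proof. by move=> c0 cc d0; apply: zeros_le_poch_weight => //; exact: zeros_le_alt_bin. Qed.

(** Since c (c + 1) (c + 2)_k = (c)_k (c + k) (c + k + 1), passing from c + 2 to c amounts, up to a
    constant, to applying (θ + c)(θ + c + 1), the operator of [zeros_le_hypergeometric]. The
    polynomial with parameter c + 2 satisfies the required recursion with b = d + N - 1. *)
Lemma zeros_le_mjacobi2 N c d : 0 < c -> 0 < d ->
    zeros_le true N (mjacobi N c d) (mjacobi N (c + 2) d).
Proof.
move=> c0 d0; have c20 : 0 < c + 2 by rewrite addr_gt0.
have [s [_ [ps _ _ _]]] := zeros_le_mjacobi_le N c20 (lexx _) d0.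
have -> : mjacobi N c d = (c * (c + 1))^-1 *: euler_op c (euler_op (c + 1) (mjacobi N (c + 2) d)).
  rewrite -(@coef_mul_euler _ N _ (mjacobi _ _ _)) ?size_coef_mul // -(@coef_mul_euler _ N)
      ?size_coef_mul //.
  rewrite coef_mul_comp; apply/polyP => k; rewrite coefZ coef_coef_mul ?size_coef_mul //.
  case: (leqP k N) => kN; last by rewrite !coef_mjacobi_gt // !mulr0.
  rewrite !coef_mjacobi //.
  have E : poch c k * (c + k%:R) * (c + k.+1%:R) = c * (c + 1) * poch (c + 2) k.
    by rewrite -!pochS !pochSl mulrA -addrA.
  have := poch_neq0 k c0; have := poch_neq0 k c20; have := poch_neq0 (N - k) d0.
  move: E; rewrite -natr1; move: (poch c k) (poch (c + 2) k) (poch d (N - k)) => A B D E D0 B0 A0.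
  have c1 : c + 1 != 0 by rewrite gt_eqF // addr_gt0.
  have -> : B = A * (c + k%:R) * (c + (k%:R + 1)) / (c * (c + 1)).
    by rewrite E; field; rewrite c1 gt_eqF.
  have k0 : 0 <= k%:R :> R by [].
  have ck1 : c + k%:R != 0 by rewrite gt_eqF // ltr_wpDr.
  have ck2 : c + (k%:R + 1) != 0 by rewrite gt_eqF // ltr_wpDr // addr_ge0.
  by field; rewrite c1 (gt_eqF c0) D0 ck2 ck1 A0.
rewrite -[X in zeros_le _ _ _ X]scale1r; apply: zeros_leZ; rewrite ?oner_eq0 //.
  by rewrite invr_eq0 mulf_neq0 ?gt_eqF // addr_gt0.
apply: (@zeros_le_hypergeometric _ _ _ s c (d + N%:R - 1)) => //.
  have N0 : 0 <= N%:R :> R by [].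
  by lra.
move=> k; case: (ltngtP k N) => kN; last first.
- by rewrite kN subrr !mul0r oppr0 mul0r coef_mjacobi_gt ?mulr0.
- by rewrite !coef_mjacobi_gt ?mulr0 // ltnW.
rewrite !coef_mjacobi ?(ltnW kN) //.
have -> : (N - k = (N - k.+1).+1)%N by lia.
rewrite !pochS exprS.
have -> : (N - k.+1)%:R = N%:R - k%:R - 1 :> R.
  by rewrite natrB // -natr1 opprD addrA.
have := congr1 (fun n => n%:R : R) (mul_bin_left N k); rewrite /= !natrM natrB ?(ltnW kN) // => E.
have := poch_neq0 k c20; have := poch_neq0 (N - k.+1) d0.
have dn : d + (N%:R - k%:R - 1) != 0.
  rewrite gt_eqF // ltr_wpDr // -addrA -opprD natr1 subr_ge0 ler_nat //.
have cn : c + 2 + k%:R != 0 by rewrite gt_eqF // ltr_wpDr.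
move: E dn cn; rewrite -natr1.
move: (poch _ k) (poch d _) ('C(N, k.+1)%:R) ('C(N, k)%:R : R) ((-1) ^+ k) =>
    A B C1 C0 sg E dn cn B0 A0.
have k1 : k%:R + 1 != 0 :> R by rewrite natr1 pnatr_eq0.
have -> : C1 = (N%:R - k%:R) * C0 / (k%:R + 1) by rewrite -E mulrAC mulfV // mul1r.
field; rewrite A0 B0 k1 /=.
move: dn cn.
have -> : d + (N%:R - k%:R - 1) = N%:R - k%:R - 1 + d by ring.
have -> : c + 2 + k%:R = k%:R + c + 2 by ring.
by move=> -> ->.
Qed.

Lemma zeros_le_mjacobi_c N c d (t : R) : 0 < c -> 0 < d -> 0 < t -> t <= 2 ->
  zeros_le true N (mjacobi N c d) (mjacobi N (c + t) d).
Proof.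
move=> c0 d0 t0 t2; apply: zeros_le_between (zeros_le_mjacobi2 N c0 d0) _ _.
  by apply: zeros_le_mjacobi_le => //; rewrite lerDl ltW.
by apply: zeros_le_mjacobi_le; rewrite ?lerD2l // addr_gt0.
Qed.

(** Through this symmetry the results in c yield those in d, with the order of zeros reversed. *)
Lemma revp_mjacobi N c d : revp N (mjacobi N c d) = (-1) ^+ N *: mjacobi N d c.
Proof.
apply/polyP => k; rewrite coefZ coef_poly; case: ltnP => kN; last by rewrite coef_mjacobi_gt ?mulr0.
have {}kN : (k <= N)%N by rewrite -ltnS.
rewrite !coef_mjacobi ?leq_subr // subKn // bin_sub // [poch d k * _]mulrC !mulrA.
have -> // : (-1) ^+ N * (-1) ^+ k = (-1) ^+ (N - k) :> R.
by rewrite -{1}(subnK kN) exprD -mulrA -expr2 sqrr_sign mulr1.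
Qed.

Lemma zeros_le_mjacobi_d N c d (t : R) : 0 < c -> 0 < d -> 0 < t -> t <= 2 ->
  zeros_le true N (mjacobi N c (d + t)) (mjacobi N c d).
Proof.
move=> c0 d0 t0 t2; have := zeros_le_revp (zeros_le_mjacobi_c N d0 c0 t0 t2).
rewrite !revp_mjacobi => /(zeros_leZ (a := (-1) ^+ N) (b := (-1) ^+ N)).
by rewrite !signr_eq0 !scalerA -expr2 sqrr_sign !scale1r => /(_ isT isT).
Qed.

(** This is 2F1(-N, c + d + N - 1; c; x), as (-N)_m / m! = (-1)^m C(N, m). *)
Definition jacobi N c d : {poly R} :=
  \poly_(m < N.+1) ((-1) ^+ m * 'C(N, m)%:R * poch (c + d + N%:R - 1) m / poch c m).

(** A form of the Chu-Vandermonde identity. Pascal's rule splits the sum for m + 1 into the sum for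
    m with (N, c, d) and, up to the factor 1 / c, the sum for m with (N - 1, c + 1, d). *)
Lemma sum_bin_poch m N c d : 0 < c -> 0 < d -> (m <= N)%N ->
  \sum_(k < m.+1) 'C(m, k)%:R / (poch c k * poch d (N - k)) =
  poch (c + d + N%:R - 1) m / (poch c m * poch d N).
Proof.
elim: m N c d => [|m IH] N c d c0 d0 mN.
  by rewrite big_ord_recl big_ord0 addr0 bin0 !poch0 subn0 !mul1r.
rewrite big_ord_recl bin0 poch0 subn0.
under eq_bigr => k _ do rewrite lift0 binS natrD mulrDl.
rewrite big_split /= addrA.
case: N mN => // N mN.
have E1 : 1 / (1 * poch d N.+1) + \sum_(k < m.+1) 'C(m, k.+1)%:R / (poch c k.+1 * poch d
    (N.+1 - k.+1)) =
    \sum_(k < m.+1) 'C(m, k)%:R / (poch c k * poch d (N.+1 - k)).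
  rewrite [RHS]big_ord_recl bin0 poch0 subn0; congr (_ + _).
  rewrite big_ord_recr /= bin_small // mul0r addr0.
  by apply: eq_bigr => k _.
rewrite E1 IH // 1?ltnW //.
have E2 : \sum_(k < m.+1) 'C(m, k)%:R / (poch c k.+1 * poch d (N.+1 - k.+1)) =
    c^-1 * \sum_(k < m.+1) 'C(m, k)%:R / (poch (c + 1) k * poch d (N - k)).
  rewrite mulr_sumr; apply: eq_bigr => k _.
  by rewrite pochSl subSS -mulrA invfM mulrCA.
rewrite E2 IH //; last by rewrite addr_gt0.
have -> : c + 1 + d + N%:R - 1 = c + d + N.+1%:R - 1 by rewrite -natr1; ring.
have c10 : 0 < c + 1 by rewrite addr_gt0.
have := poch_neq0 m c0; have := poch_neq0 N d0; have := poch_neq0 m c10.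
have E3 : c * poch (c + 1) m = poch c m * (c + m%:R) by rewrite -pochSl pochS.
have -> : poch (c + 1) m = poch c m * (c + m%:R) / c.
  by rewrite -E3 mulrC mulKf // gt_eqF.
rewrite !pochS -natr1.
have cm : c + m%:R != 0 by rewrite gt_eqF // ltr_wpDr.
have dN : d + N%:R != 0 by rewrite gt_eqF // ltr_wpDr.
have c0' : c != 0 by rewrite gt_eqF.
move: (poch _ m) (poch _ m) (poch d N) => P A B A0 B0 C0.
by field; rewrite cm dN c0' C0 B0.
Qed.

Lemma mul_bin_trinom N m k : (k <= m)%N -> (m <= N)%N ->
  ('C(N, m) * 'C(m, k) = 'C(N, k) * 'C(N - k, m - k))%N.
Proof.
move=> km mN; have kN := leq_trans km mN.
have f0 n : (0 < n`!)%N by exact: fact_gt0.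
apply/eqP; rewrite -(eqn_pmul2r (f0 k)) -(eqn_pmul2r (f0 (m - k)%N)) -(eqn_pmul2r (f0 (N - m)%N)).
have h1 := bin_fact mN; have h2 := bin_fact km; have h3 := bin_fact kN.
have h4 : ('C(N - k, m - k) * ((m - k)`! * (N - m)`!) = (N - k)`!)%N.
  by have -> : (N - m = (N - k) - (m - k))%N; [lia | apply: bin_fact; lia].
apply/eqP; transitivity (N`!).
  rewrite -h1 -h2; ring.
by rewrite -h3 -h4; ring.
Qed.

Lemma sum_bin_shift N k (y : R) : (k <= N)%N ->
  \sum_(m < N.+1 | (k <= m)%N) 'C(N - k, m - k)%:R * y ^+ m = y ^+ k * (1 + y) ^+ (N - k).
Proof.
move=> kN; rewrite -(big_geq_mkord k N.+1 xpredT (fun m => 'C(N - k, m - k)%:R * y ^+ m)).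
rewrite -[k in \sum_(k <= _ < _) _]add0n big_addn big_mkord subSn // exprDn mulr_sumr.
apply: eq_bigr => j _; rewrite addnK expr1n mul1r exprD -[in RHS]mulr_natr; ring.
Qed.

(** Each coefficient is expanded by [sum_bin_poch] and the two sums are exchanged; the inner sum is
    then (-x)^k times the binomial expansion of (1 - x)^(N-k). *)
Lemma horner_jacobi N c d x : 0 < c -> 0 < d ->
  (jacobi N c d).[x] = poch d N * \sum_(k < N.+1) (mjacobi N c d)`_k * x ^+ k * (1 - x) ^+ (N - k).
Proof.
move=> c0 d0; rewrite (horner_coef_wide _ (size_poly _ _)).
pose F k m := poch d N * ('C(N, k)%:R / (poch c k * poch d (N - k)) *
  ('C(N - k, m - k)%:R * (- x) ^+ m)).
transitivity (\sum_(m < N.+1) \sum_(k < N.+1 | (k < m.+1)%N) F k m).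
  apply: eq_bigr => m _; have mN : (m <= N)%N by rewrite -ltnS.
  rewrite -(big_ord_widen _ (fun k => F k m)) // coef_poly ltn_ord.
  have -> : (-1) ^+ m * 'C(N, m)%:R * poch (c + d + N%:R - 1) m / poch c m =
      (-1) ^+ m * 'C(N, m)%:R * poch d N * (poch (c + d + N%:R - 1) m / (poch c m * poch d N)).
    by field; rewrite !poch_neq0.
  rewrite -sum_bin_poch // mulrAC mulr_sumr; apply: eq_bigr => k _.
  have := congr1 (fun n => n%:R : R) (@mul_bin_trinom N m k _ mN).
  rewrite -ltnS ltn_ord /F [(- x) ^+ m]exprNn !natrM => /(_ isT).
  move: ('C(N, m)%:R : R) ('C(m, k)%:R : R) ('C(N, k)%:R : R) ('C(N - k, m - k)%:R : R) =>
      C1 C2 C3 C4 E.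
  move: (poch d N) (_^-1) => P z; transitivity (P * ((C3 * C4) * z * ((-1) ^+ m * x ^+ m)));
      last by ring.
  by rewrite -E; ring.
rewrite (exchange_big_dep xpredT) //= mulr_sumr; apply: eq_bigr => k _.
have kN : (k <= N)%N by rewrite -ltnS.
rewrite /F -mulr_sumr -mulr_sumr; congr (_ * _).
under eq_bigl => m do rewrite ltnS.
rewrite sum_bin_shift // coef_mjacobi // [(- x) ^+ k]exprNn.
by move: (_^-1) => z; ring.
Qed.

(** By [horner_jacobi] the polynomial is, up to a constant, (1 - x)^N K(x / (1 - x)) with K =
    [mjacobi N c d], and x / (1 - x) = z is solved by x = z / (1 + z). *)
Lemma pos_zeros_jacobi N c d z : 0 < c -> 0 < d -> pos_zeros N (mjacobi N c d) z ->
  pos_zeros N (jacobi N c d) (fun i => z i / (1 + z i)).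
Proof.
move=> c0 d0 pz; have [p0 pE zl z0] := pz; have sp := pos_zeros_size pz.
have z1 i : (i < N)%N -> 0 < 1 + z i by move=> iN; rewrite addr_gt0 // z0.
apply: (@pos_zerosI _ _ (poch d N * lead_coef (mjacobi N c d) * \prod_(i < N) (1 + z i))).
- rewrite !mulf_neq0 ?poch_neq0 ?lead_coef_eq0 //; apply/prodf_neq0 => i _.
  by rewrite gt_eqF // z1.
- apply: poly_horner_inj => x x1; rewrite horner_jacobi // hornerZ -!mulrA; congr (_ * _).
  have x1' : 1 - x != 0 by rewrite subr_eq0 lt_eqF.
  transitivity ((1 - x) ^+ N * (mjacobi N c d).[x / (1 - x)]).
    have -> : (mjacobi N c d).[x / (1 - x)] =
        \sum_(k < N.+1) (mjacobi N c d)`_k * (x / (1 - x)) ^+ k.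
      by apply: horner_coef_wide; rewrite sp.
    rewrite mulr_sumr; apply: eq_bigr => k _; have kN : (k <= N)%N by rewrite -ltnS.
    have -> : (1 - x) ^+ N = (1 - x) ^+ (N - k) * (1 - x) ^+ k by rewrite -exprD subnK.
    rewrite exprMn exprVn.
    by field; rewrite expf_neq0.
  rewrite {1}pE hornerZ mulrCA; congr (_ * _).
  rewrite !horner_prodX -[in _ ^+ N](card_ord N) -prodr_const -!big_split /=.
  by apply: eq_bigr => i _; have := z1 _ (ltn_ord i) => zi; field; rewrite (gt_eqF zi).
- move=> i j ij jN; have iN := leq_ltn_trans ij jN.
  rewrite ler_pdivrMr ?z1 // mulrAC ler_pdivlMr ?z1 //.
  by have := zl _ _ ij jN; lra.
- by move=> i iN; rewrite divr_gt0 ?z0 ?z1.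
Qed.

Lemma zeros_le_jacobi e N c d c' d' : 0 < c -> 0 < d -> 0 < c' -> 0 < d' ->
  zeros_le e N (mjacobi N c d) (mjacobi N c' d') -> zeros_le e N (jacobi N c d) (jacobi N c' d').
Proof.
move=> c0 d0 c0' d0' [s [t [ps qt st ts]]].
have [_ _ _ s0] := ps; have [_ _ _ t0] := qt.
have mono (y z : R) : 0 < y -> 0 < z -> y <= z -> y / (1 + y) <= z / (1 + z).
  move=> y0 z0 yz; rewrite ler_pdivrMr ?addr_gt0 // mulrAC ler_pdivlMr ?addr_gt0 //.
  by lra.
exists (fun i => s i / (1 + s i)), (fun i => t i / (1 + t i)).
split; [exact: pos_zeros_jacobi | exact: pos_zeros_jacobi | |].
  by move=> i iN; apply: mono; [exact: s0 | exact: t0 | exact: st].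
by move=> ee i iN; apply: mono; [exact/t0/ltnW | exact: s0 | exact: ts].
Qed.

Lemma jacobi_zeros_01 N c d : 0 < c -> 0 < d ->
  exists2 s, pos_zeros N (jacobi N c d) s & forall i, (i < N)%N -> s i < 1.
Proof.
move=> c0 d0; have [z [_ [pz _ _ _]]] := zeros_le_mjacobi_le N c0 (lexx _) d0.
exists (fun i => z i / (1 + z i)); first exact: pos_zeros_jacobi.
have [_ _ _ z0] := pz; move=> i iN; have := z0 _ iN => zi.
by rewrite ltr_pdivrMr ?addr_gt0 // mul1r ltrDr.
Qed.

(** Since (d)_N = (-1)^m (d)_(N-m) (1 - d - N)_m, each pair (c_j, d_j) in [l] contributes to the
    hypergeometric series an upper parameter 1 - d_j - N, a lower parameter c_j and a change of sign
    of x, up to a constant. *)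
Definition pineiro N c d (l : seq (R * R)) : {poly R} :=
  coef_mul N (fun m => \prod_(y <- l) poch_weight N y.1 y.2 m) (jacobi N c d).

Lemma size_jacobi N c d : (size (jacobi N c d) <= N.+1)%N.
Proof. exact: size_poly. Qed.

Lemma pineiro_nil N c d : pineiro N c d [::] = jacobi N c d.
Proof. by apply/polyP => k; rewrite coef_coef_mul ?size_jacobi // big_nil mul1r. Qed.

Lemma zeros_le_pineiro e N c d c' d' (l : seq (R * R)) : (forall y, y \in l ->
    0 < y.1 /\ 0 < y.2) ->
  zeros_le e N (jacobi N c d) (jacobi N c' d') ->
      zeros_le e N (pineiro N c d l) (pineiro N c' d' l).
Proof.
move=> + H; elim: l => [|y l IH] l0; first by rewrite !pineiro_nil.
have E a b : pineiro N a b (y :: l) = coef_mul N (poch_weight N y.1 y.2) (pineiro N a b l).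
  by rewrite /pineiro coef_mul_comp; apply: eq_coef_mul => k _; rewrite big_cons.
have [y1 y2] := l0 y (mem_head _ _).
rewrite !E; apply: zeros_le_poch_weight => //; apply: IH => x xl; apply: l0.
by rewrite inE xl orbT.
Qed.

Lemma zeros_le_pineiro_c N c d (t : R) l : (forall y, y \in l -> 0 < y.1 /\ 0 < y.2) ->
  0 < c -> 0 < d -> 0 < t -> t <= 2 -> zeros_le true N (pineiro N c d l) (pineiro N (c + t) d l).
Proof.
by move=> l0 c0 d0 t0 t2; apply: zeros_le_pineiro => //; apply: zeros_le_jacobi;
    rewrite ?addr_gt0 //; exact: zeros_le_mjacobi_c.
Qed.

Lemma zeros_le_pineiro_d N c d (t : R) l : (forall y, y \in l -> 0 < y.1 /\ 0 < y.2) ->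
  0 < c -> 0 < d -> 0 < t -> t <= 2 -> zeros_le true N (pineiro N c (d + t) l) (pineiro N c d l).
Proof.
by move=> l0 c0 d0 t0 t2; apply: zeros_le_pineiro => //; apply: zeros_le_jacobi;
    rewrite ?addr_gt0 //; exact: zeros_le_mjacobi_d.
Qed.

End Jacobi.

(** * The beta integral *)

Section Beta.
Local Open Scope classical_set_scope.
Local Open Scope ring_scope.
Variable R : realType.
Implicit Types (s b x : R).
Local Notation mu := (@lebesgue_measure R).

Definition betaw s b x := x `^ s * (1 - x) `^ b.

Lemma betaw_ge0 s b x : 0 <= betaw s b x.
Proof. by rewrite mulr_ge0 ?powR_ge0. Qed.

Lemma measurable_betaw s b (A : set R) : measurable_fun A (betaw s b).
Proof.
apply: measurable_funTS; apply: measurable_funM.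
  exact: measurable_powR.
apply: (measurableT_comp (measurable_powR b)).
by apply: measurable_funB.
Qed.

Lemma measurable_EFin_betaw s b (A : set R) : measurable_fun A (fun x => (betaw s b x)%:E).
Proof. by apply/measurable_EFinP; exact: measurable_betaw. Qed.

Lemma powR_S x s : 0 < x -> x `^ (s + 1) = x * x `^ s.
Proof.
move=> x0; rewrite powRD; last by rewrite (gt_eqF x0) implybT.
by rewrite powRr1 ?(ltW x0) // mulrC.
Qed.

Lemma is_derive_betaw s b x : 0 < x < 1 ->
  is_derive x 1 (betaw (s + 1) (b + 1)) ((s + 1) * betaw s (b + 1) x - (b + 1) * betaw (s + 1) b x).
Proof.
move=> /andP[x0 x1]; have x10 : 0 < 1 - x by rewrite subr_gt0.
have d1 := is_derive1_powR (s + 1) x0; rewrite addrK in d1.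
have d2 := is_derive1_powR (b + 1) x10; rewrite addrK in d2.
have d3 : is_derive x 1 (fun y : R => 1 - y) (-1).
  have := is_deriveB (is_derive_cst (1 : R) x 1) (is_derive_id x 1); rewrite sub0r; exact.
have d4 : is_derive x 1 (fun y : R => (1 - y) `^ (b + 1)) ((b + 1) * (1 - x) `^ b * -1).
  exact: (@is_derive1_comp R (fun y : R => y `^ (b + 1)) (fun y : R => 1 - y)).
apply: (is_derive_eq (is_deriveM d1 d4)).
by rewrite /betaw /GRing.scale /=; ring.
Qed.

Lemma continuous_betaw s b x : 0 < x < 1 -> {for x, continuous (betaw s b)}.
Proof.
move=> x01; have := @is_derive_betaw (s - 1) (b - 1) x x01; rewrite !subrK => d.
by apply: differentiable_continuous; apply/derivable1_diffP; exact: ex_derive.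
Qed.

Definition betaI s b : \bar R := (\int[mu]_(x in `]0%R, 1%R[) (betaw s b x)%:E)%E.

(** The integrand is multiplied by x + (1 - x) = 1. *)
Lemma betaI_split s b : betaI s b = (betaI (s + 1) b + betaI s (b + 1))%E.
Proof.
rewrite /betaI -ge0_integralD //=; last 4 first.
- by move=> x _; rewrite lee_fin betaw_ge0.
- exact: measurable_EFin_betaw.
- by move=> x _; rewrite lee_fin betaw_ge0.
- exact: measurable_EFin_betaw.
apply: eq_integral => x; rewrite inE /= in_itv /= => /andP[x0 x1].
rewrite -EFinD /betaw !powR_S ?subr_gt0 //; congr (_%:E); ring.
Qed.

(** Cutoffs tending to 0; the shift by 3 makes [e n] less than 1/2, so that [e n, 1 - e n] is a
    proper interval. *)
Let e (n : nat) : R := (n.+3%:R)^-1.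

Let e_gt0 n : 0 < e n. Proof. by rewrite invr_gt0. Qed.

Let e_lt n : e n < 1 - e n.
Proof.
have : e n <= 3^-1 by rewrite lef_pV2 ?posrE // ler_nat.
by move: (e n) => y; lra.
Qed.

Let e_cvg : e @ \oo --> (0 : R).
Proof.
have -> : e = (fun n => harmonic (n + 2)%N) by apply/funext => n; rewrite /e /harmonic /= addn2.
by have := @cvg_harmonic R; rewrite -(cvg_shiftn 2).
Qed.

Let boundary_cvg s b : -1 < s -> -1 < b -> betaw (s + 1) (b + 1) (e n) @[n --> \oo] --> (0 : R).
Proof.
move=> s1 b1.
have s10 : 0 < s + 1 by rewrite -ltrBlDr sub0r.
have b10 : 0 < b + 1 by rewrite -ltrBlDr sub0r.
have [+ _] := cvg_at_rightP (fun a => a `^ (s + 1)) 0 0.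
move=> /(_ (powR_cvg0 s10) e (conj e_gt0 e_cvg)) H.
apply: (squeeze_cvgr _ (cvg_cst 0) H); near=> n.
rewrite betaw_ge0 /= /betaw -[X in _ <= X]mulr1 ler_wpM2l ?powR_ge0 //.
have e01 : 0 < 1 - e n <= 1.
  by have := e_gt0 n; have := e_lt n; move: (e n) => y *; apply/andP; split; lra.
by have := ger_powR e01 (ltW b10); rewrite powRr0.
Unshelve. all: by end_near. Qed.

Lemma betaw_sym s b x : betaw s b (1 - x) = betaw b s x.
Proof. by rewrite /betaw subKr mulrC. Qed.

(** The derivative of x^(s+1) (1 - x)^(b+1) is integrated over [e n, 1 - e n]. The boundary terms
    tend to 0 because both exponents are positive, and the integrals converge because the intervals
    increase to (0, 1). The identity is in the extended reals because finiteness is deduced from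
    it. *)
Lemma betaI_parts s b : -1 < s -> -1 < b ->
  ((s + 1)%:E * betaI s (b + 1) = (b + 1)%:E * betaI (s + 1) b)%E.
Proof.
move=> s1 b1.
have s10 : 0 < s + 1 by rewrite -ltrBlDr sub0r.
have b10 : 0 < b + 1 by rewrite -ltrBlDr sub0r.
pose f1 x := (s + 1) * betaw s (b + 1) x.
pose f2 x := (b + 1) * betaw (s + 1) b x.
have f10 x : 0 <= f1 x by rewrite mulr_ge0 ?betaw_ge0 // ltW.
have f20 x : 0 <= f2 x by rewrite mulr_ge0 ?betaw_ge0 // ltW.
have mf1 (A : set R) : measurable_fun A (EFin \o f1).
  by apply/measurable_EFinP; apply: measurable_funM => //; exact: measurable_betaw.
have mf2 (A : set R) : measurable_fun A (EFin \o f2).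
  by apply/measurable_EFinP; apply: measurable_funM => //; exact: measurable_betaw.
pose F (n : nat) := `[e n, 1 - e n]%classic.
have FU : \bigcup_n F n = `]0%R, 1%R[%classic.
  apply/seteqP; split=> x.
    move=> [n _]; rewrite /F /= !in_itv /= => /andP[h1 h2].
    by rewrite (lt_le_trans (e_gt0 n) h1) (le_lt_trans h2) // ltrBlDr ltrDl.
  rewrite /= in_itv /= => /andP[x0 x1].
  have /cvgrPdist_lt e0 := e_cvg.
  have m0 : 0 < Num.min x (1 - x) by rewrite lt_min x0 subr_gt0.
  have [N _ HN] := e0 _ m0.
  exists N => //; have := HN N (leqnn _); rewrite /= sub0r normrN (gtr0_norm (e_gt0 N)).
  rewrite lt_min /F /= in_itv /= => /andP[h1 h2].
  by rewrite (ltW h1) lerBrDr addrC -lerBrDr ltW.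
have ndF : nondecreasing_seq F.
  apply/nondecreasing_seqP => n; rewrite subsetEset => x; rewrite /F /= !in_itv /=.
  have : e n.+1 <= e n by rewrite lef_pV2 ?posrE // ler_nat.
  by move: (e n) (e n.+1) => y z zy /andP[h1 h2]; apply/andP; split; lra.
have F01 n x : F n x -> 0 < x < 1.
  by move=> Fx; have : (\bigcup_n F n) x by [exists n]; rewrite FU /= in_itv.
have cv (f : R -> R) : (forall x, 0 <= f x) -> (forall A : set R, measurable_fun A (EFin \o f)) ->
    (\int[mu]_(x in F n) (f x)%:E)%E @[n --> \oo] --> (\int[mu]_(x in `]0%R, 1%R[) (f x)%:E)%E.
  move=> f0 mf; rewrite -FU.
  have := @ge0_nondecreasing_set_cvg_integral _ (measurableTypeR R) R F (EFin \o f) mu ndF.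
  move=> H; apply: H.
  - by move=> n; exact: measurable_itv.
  - by move=> n; exact: mf.
  - by move=> n x _; rewrite lee_fin.
pose G := betaw (s + 1) (b + 1).
have E n : (\int[mu]_(x in F n) (f1 x)%:E =
    \int[mu]_(x in F n) (f2 x)%:E + (G (1 - e n) - G (e n))%:E)%E.
  have cf1 x : 0 < x < 1 -> {for x, continuous f1}.
    by move=> x01; apply: continuousM; [exact: cst_continuous | exact: continuous_betaw].
  have cf2 x : 0 < x < 1 -> {for x, continuous f2}.
    by move=> x01; apply: continuousM; [exact: cst_continuous | exact: continuous_betaw].
  have c2 : {within F n, continuous f2}.
    by apply: continuous_in_subspaceT => x; rewrite inE => /F01; exact: cf2.
  have c12 : {within F n, continuous (f1 \- f2)}.
    apply: continuous_in_subspaceT => x; rewrite inE => /F01 x01.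
    by apply: continuousB; [exact: cf1 | exact: cf2].
  have dG x : x \in `]e n, 1 - e n[ -> is_derive x 1 G (f1 x - f2 x).
    rewrite in_itv /= => /andP[h1 h2]; apply: is_derive_betaw.
    by rewrite (lt_trans (e_gt0 n) h1) (lt_trans h2) // ltrBlDr ltrDl.
  have cG x : 0 < x < 1 -> G @ x --> G x by exact: continuous_betaw.
  have en01 : 0 < e n < 1.
    by have := e_gt0 n; have := e_lt n; move: (e n) => y *; apply/andP; split; lra.
  have en01' : 0 < 1 - e n < 1.
    by move: en01; move: (e n) => y /andP[*]; apply/andP; split; lra.
  have dLR : derivable_oo_LRcontinuous G (e n) (1 - e n).
    split.
    - by move=> x /dG [].
    - by apply: cvg_at_right_filter; exact: cG.
    - by apply: cvg_at_left_filter; exact: cG.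
  have dE : {in `]e n, 1 - e n[, derive1 G =1 f1 \- f2}.
    by move=> x /dG d; rewrite derive1E derive_val.
  have := @continuous_FTC2 R (f1 \- f2) G (e n) (1 - e n) (e_lt n) c12 dLR dE.
  rewrite -EFinB => <-; rewrite -integralD_EFin //=.
  - by apply: eq_integral => x _; rewrite -EFinD addrC subrK.
  - exact: measurable_itv.
  - apply: (@continuous_compact_integrable R f2); [exact: segment_compact | exact: c2].
  - apply: (@continuous_compact_integrable R (f1 \- f2)); [exact: segment_compact | exact: c12].
have bc : (G (1 - e n) - G (e n))%:E @[n --> \oo] --> (0%R)%:E.
  apply: cvg_EFin; first by near=> n.
  have -> : (0 : R) = 0 - 0 by rewrite subr0.
  apply: cvgB; last exact: boundary_cvg.
  by rewrite /G; under eq_fun do rewrite betaw_sym; exact: boundary_cvg.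
have c1 := cv f1 f10 mf1; have c2 := cv f2 f20 mf2.
have c3 := cvgeD _ c2 bc; rewrite adde0 in c3.
have {}c3 : (\int[mu]_(x in F n) (f1 x)%:E)%E @[n --> \oo] --> (\int[mu]_(x in `]0%R, 1%R[)
    (f2 x)%:E)%E.
  by under eq_fun do rewrite E; apply: c3; rewrite fin_num_adde_defl.
have := cvg_unique _ c1 c3.
rewrite /betaI -!ge0_integralZl_EFin ?ltW //; last 4 first.
- by move=> x _; rewrite lee_fin betaw_ge0.
- exact: measurable_EFin_betaw.
- by move=> x _; rewrite lee_fin betaw_ge0.
- exact: measurable_EFin_betaw.
by rewrite /f1 /f2; under eq_integral do rewrite EFinM; 
  under [in RHS]eq_integral do rewrite EFinM; apply; exact: ereal_hausdorff.
Unshelve. all: by end_near. Qed.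

End Beta.

(** * Finiteness and recurrences of the beta integral; moments of the linear form *)

Section Moments.
Local Open Scope classical_set_scope.
Local Open Scope ring_scope.
Variable R : realType.
Implicit Types (s b x : R).
Local Notation mu := (@lebesgue_measure R).

Lemma le_betaI s b s' b' : s' <= s -> b' <= b -> (betaI s b <= betaI s' b')%E.
Proof.
move=> ss bb; apply: ge0_le_integral.
- exact: measurable_itv.
- by move=> x _; rewrite lee_fin betaw_ge0.
- exact: measurable_EFin_betaw.
- exact: measurable_EFin_betaw.
move=> x; rewrite /= in_itv /= => /andP[x0 x1]; rewrite lee_fin.
by apply: ler_pM; rewrite ?powR_ge0 //; apply: ger_powR => //; lra.
Qed.

Lemma betaI00 : betaI 0 0 = 1%E :> \bar R.
Proof.
rewrite /betaI; under eq_integral do rewrite /betaw !powRr0 mulr1.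
by rewrite integral_cst //= mul1e lebesgue_measure_itv /= lte_fin ltr01 oppr0 adde0.
Qed.

(** If one summand of [betaI_split] is finite, [betaI_parts] makes the other finite too. The descent
    starts from the exponents s + 1 and b + 1, which are positive, so that the integral is at most
    1. *)
Lemma betaI_fin_num s b : -1 < s -> -1 < b -> betaI s b \is a fin_num.
Proof.
have ge0 s' b' : (0 <= betaI s' b')%E.
  by apply: integral_ge0 => x _; rewrite lee_fin betaw_ge0.
have step1 s' b' : -1 < s' -> -1 < b' -> betaI (s' + 1) b' \is a fin_num ->
    betaI s' b' \is a fin_num.
  move=> s1 b1 f1; rewrite betaI_split fin_numD f1 /=.
  have s10 : 0 < s' + 1 by rewrite -ltrBlDr sub0r.
  have := betaI_parts s1 b1; rewrite -(fineK f1) -EFinM => H.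
  rewrite ge0_fin_numE //; rewrite ltey; apply/eqP => HH; move: H; rewrite HH.
  by rewrite mulry gtr0_sg // mul1e.
have step2 s' b' : -1 < s' -> -1 < b' -> betaI s' (b' + 1) \is a fin_num ->
    betaI s' b' \is a fin_num.
  move=> s1 b1 f1; rewrite betaI_split fin_numD f1 andbT.
  have b10 : 0 < b' + 1 by rewrite -ltrBlDr sub0r.
  have := betaI_parts s1 b1; rewrite -(fineK f1) -EFinM => H.
  rewrite ge0_fin_numE //; rewrite ltey; apply/eqP => HH; move: H; rewrite HH.
  by rewrite mulry gtr0_sg // mul1e.
move=> s1 b1; apply: step1 => //; apply: step2 => //; first by lra.
rewrite ge0_fin_numE // (le_lt_trans (@le_betaI _ _ 0 0 _ _)) ?betaI00 ?ltry //; lra.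
Qed.

Definition betaR s b : R := fine (betaI s b).

Lemma betaI_E s b : -1 < s -> -1 < b -> betaI s b = (betaR s b)%:E.
Proof. by move=> s1 b1; rewrite fineK // betaI_fin_num. Qed.

Lemma betaR_split s b : -1 < s -> -1 < b -> betaR s b = betaR (s + 1) b + betaR s (b + 1).
Proof.
move=> s1 b1; have := betaI_split s b.
by rewrite !betaI_E -?EFinD => [[]||||||]; lra.
Qed.

Lemma betaR_parts s b : -1 < s -> -1 < b -> (s + 1) * betaR s (b + 1) = (b + 1) * betaR (s + 1) b.
Proof.
move=> s1 b1; have := betaI_parts s1 b1.
by rewrite !betaI_E -?EFinM => [[]||||]; lra.
Qed.

Lemma betaR_Sl s b : -1 < s -> -1 < b -> betaR (s + 1) b = (s + 1) / (s + b + 2) * betaR s b.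
Proof.
move=> s1 b1; have := betaR_split s1 b1; have := betaR_parts s1 b1 => H ->.
have d : s + b + 2 != 0 by apply: lt0r_neq0; lra.
by apply: (mulfI d); rewrite mulrA mulrCA mulfV // mulr1 mulrDr H; ring.
Qed.

Lemma betaR_Sr s b : -1 < s -> -1 < b -> betaR s (b + 1) = (b + 1) / (s + b + 2) * betaR s b.
Proof.
move=> s1 b1; have := betaR_split s1 b1; have := betaR_parts s1 b1 => H ->.
have d : s + b + 2 != 0 by apply: lt0r_neq0; lra.
by apply: (mulfI d); rewrite mulrA mulrCA mulfV // mulr1 mulrDr -H; ring.
Qed.

(** The integral decreases in its exponents, so it is bounded below by its value at a large natural
    number; that value is positive by the recurrences, starting from [betaI00]. *)
Lemma betaR_gt0 s b : -1 < s -> -1 < b -> 0 < betaR s b.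
Proof.
move=> s1 b1.
have [m [sm bm]] : exists m : nat, s <= m%:R /\ b <= m%:R.
  exists (Num.bound `|s| + Num.bound `|b|)%N; rewrite natrD.
  have h1 := archi_boundP (normr_ge0 s); have h2 := archi_boundP (normr_ge0 b).
  have := ler_norm s; have := ler_norm b.
  have := @ler0n R (Num.bound `|s|); have := @ler0n R (Num.bound `|b|).
  by split; lra.
have n1 k : -1 < k%:R :> R by rewrite (lt_le_trans _ (ler0n _ _)) // ltrN10.
have : 0 < betaR m%:R m%:R.
  have r0 (k : nat) : 0 < betaR k%:R 0.
    elim: k => [|k IH]; first by rewrite /betaR betaI00.
    rewrite -natr1 betaR_Sl ?n1 // ?ltrN10 // mulr_gt0 // divr_gt0 //; have := @ler0n R k; lra.
  have H (k : nat) : 0 < betaR m%:R k%:R.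
    elim: k => [|k IH]; first exact: r0.
    rewrite -natr1 betaR_Sr ?n1 // mulr_gt0 // divr_gt0 //; have := @ler0n R k;
        have := @ler0n R m; lra.
  exact: H.
move=> h; apply: (lt_le_trans h).
by rewrite -lee_fin -!betaI_E ?n1 //; exact: le_betaI.
Qed.

Lemma jp_formE r (alpha : 'I_r -> R) (beta : R) (n : 'I_r -> nat) (P : 'I_r -> {poly R}) k x :
  (forall j, (size (P j) <= n j)%N) -> 0 < x < 1 ->
  jp_form alpha beta P x * x ^+ k =
  \sum_(j < r) \sum_(m < n j) (P j)`_m * betaw (alpha j + (m + k)%:R) beta x.
Proof.
move=> sP /andP[x0 x1]; rewrite /jp_form mulr_suml; apply: eq_bigr => j _.
rewrite (horner_coef_wide _ (sP j)) !mulr_suml; apply: eq_bigr => m _.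
rewrite /betaw powRD; last by rewrite (gt_eqF x0) implybT.
by rewrite powR_mulrn ?ltW // exprD; ring.
Qed.

Lemma jp_momentE r (alpha : 'I_r -> R) (beta : R) (n : 'I_r -> nat) (P : 'I_r -> {poly R}) k :
  (forall j, -1 < alpha j) -> -1 < beta -> (forall j, (size (P j) <= n j)%N) ->
  jp_moment alpha beta P k =
  (\sum_(j < r) \sum_(m < n j) (P j)`_m * betaR (alpha j + m%:R + k%:R) beta)%:E.
Proof.
move=> a1 b1 sP; rewrite /jp_moment.
have am j (m : nat) : -1 < alpha j + m%:R by rewrite ltr_wpDr.
have int s : -1 < s -> mu.-integrable `]0%R, 1%R[ (fun x => (betaw s beta x)%:E).
  move=> s1; apply/integrableP; split; first exact: measurable_EFin_betaw.
  under eq_integral do rewrite gee0_abs ?lee_fin ?betaw_ge0 //.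
  by rewrite -[X in (X < _)%E]/(betaI s beta) betaI_E // ltry.
transitivity (\int[mu]_(x in `]0%R, 1%R[) \sum_(j < r) \sum_(m < n j)
    (((P j)`_m)%:E * (betaw (alpha j + (m + k)%:R) beta x)%:E))%E.
  apply: eq_integral => x; rewrite inE /= in_itv /= => x01.
  rewrite (jp_formE _ _ _ sP) // -sumEFin; apply: eq_bigr => j _.
  by rewrite -sumEFin; apply: eq_bigr => m _; rewrite EFinM.
rewrite integral_sum //; last first.
  move=> j; apply: integrable_sum => // m _; apply: integrableZl => //; exact: int.
rewrite -sumEFin; apply: eq_bigr => j _.
rewrite integral_sum //; last by move=> m; apply: integrableZl => //; exact: int.
rewrite -sumEFin; apply: eq_bigr => m _.
rewrite integralZl //; last exact: int.
by rewrite -[X in (_ * X)%E]/(betaI _ _) betaI_E // EFinM natrD addrA.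
Qed.

End Moments.

(** * Moment conditions and residues *)

Section Nodes.
Local Open Scope classical_set_scope.
Local Open Scope ring_scope.
Variables (R : realType) (T : finType) (s : T -> R) (beta : R).
Hypotheses (s_gt : forall i, -1 < s i) (s_inj : injective s) (beta_gt : -1 < beta).
Implicit Types (p : T -> R) (g : {poly R}).

(** The contribution of the term p_i x^(s_i) to the integral against (1 - x)^(beta + K). *)
Definition weight (K : nat) p i : R := p i * betaR (s i) (beta + K%:R).

Let addn_gt (x : R) (k : nat) : -1 < x -> -1 < x + k%:R.
Proof. by move=> x1; rewrite ltr_wpDr. Qed.

Lemma weight_eq0 K p i : weight K p i = 0 -> p i = 0.
Proof.
by move/eqP; rewrite mulf_eq0 (gt_eqF (betaR_gt0 _ _)) ?addn_gt // orbF => /eqP.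
Qed.

(** The span of 1, x, ..., x^K contains x^l (1 - x)^k for k + l <= K. *)
Lemma moment_shift K p : (forall k, (k <= K)%N -> \sum_i p i * betaR (s i + k%:R) beta = 0) ->
  forall k l, (k + l <= K)%N -> \sum_i p i * betaR (s i + l%:R) (beta + k%:R) = 0.
Proof.
move=> H; elim=> [|k IH] l klK.
  by under eq_bigr do rewrite addr0; exact: H.
have := IH l (leq_trans (leqnSn _) klK).
under eq_bigr => i _ do rewrite betaR_split ?addn_gt // mulrDr -!addrA !natr1.
by rewrite big_split /= IH ?add0r // addnS -addSn.
Qed.

(** Replacing (1 - x)^(beta + K) by (1 - x)^(beta + K - m) multiplies the integral of x^s, up to a
    constant, by a polynomial of degree m in s. The vanishing moments thus give orthogonality to one
    polynomial of each degree m <= K, hence to all of them. *)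
Lemma weight_ortho K p : (forall k, (k <= K)%N -> \sum_i p i * betaR (s i + k%:R) beta = 0) ->
  forall g, (size g <= K.+1)%N -> \sum_i weight K p i * g.[s i] = 0.
Proof.
move=> H.
(* Chosen so that s - c_l = s + beta + K + 1 - l, the denominator in [betaR_Sr] at the exponent beta
   + K - l - 1. *)
pose c (i : nat) := - (beta + K%:R + 1 - i%:R).
have base m : (m <= K)%N -> \sum_i weight K p i * (prodX m c).[s i] = 0.
  move=> mK.
  have pos (i : nat) : (i < m)%N -> 0 < beta + K%:R - i%:R.
    move=> im; have := beta_gt; have : i.+1%:R <= K%:R :> R by rewrite ler_nat (leq_trans im).
    by rewrite -natr1; lra.
  have E i : betaR (s i) (beta + (K - m)%:R) * \prod_(l < m) (beta + K%:R - l%:R) =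
      betaR (s i) (beta + K%:R) * (prodX m c).[s i].
    elim: m mK pos => [|m IH] mK pos.
      by rewrite subn0 horner_prodX !big_ord0 !mulr1.
    rewrite horner_prodX !big_ord_recr /= -(horner_prodX m c (s i)).
    transitivity ((betaR (s i) (beta + (K - m)%:R) * \prod_(l < m) (beta + K%:R - l%:R)) *
        (s i - c m)).
      have -> : (K - m = (K - m.+1).+1)%N by lia.
      rewrite -natr1 addrA betaR_Sr ?addn_gt // natrB // -natr1 /c.
      have d : s i + (beta + (K%:R - (m%:R + 1))) + 2 != 0.
        by apply: lt0r_neq0; have := pos _ (ltnSn m); have := s_gt i; lra.
      by field.
    by rewrite IH -?mulrA // ?(ltnW mK) // => l lm; apply: pos; exact: ltnW.
  have P0 : \prod_(l < m) (beta + K%:R - l%:R) != 0.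
    by apply/prodf_neq0 => l _; rewrite gt_eqF // pos.
  under eq_bigr => i _ do rewrite /weight -mulrA -E mulrA.
  rewrite -mulr_suml.
  have := @moment_shift K p H (K - m) 0; rewrite addn0 => /(_ (leq_subr _ _)).
  by under eq_bigr do rewrite addr0; move=> ->; rewrite mul0r.
have main m : (m <= K.+1)%N -> forall g, (size g <= m)%N -> \sum_i weight K p i * g.[s i] = 0.
  elim: m => [|m IH] mK h sh.
    move: sh; rewrite leqn0 size_poly_eq0 => /eqP ->.
    by apply: big1 => i _; rewrite horner0 mulr0.
  have sh' : (size (h - h`_m *: prodX m c)%R <= m)%N.
    apply/leq_sizeP => j; rewrite leq_eqVlt => /orP[/eqP <-|mj].
      by rewrite coefB coefZ prodX_coefN mulr1 subrr.
    rewrite coefB coefZ [h`_j]nth_default ?(leq_trans sh mj) //.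
    by rewrite [(prodX _ _)`_j]nth_default ?size_prodX // mulr0 subr0.
  have := IH (ltnW mK) _ sh'.
  under eq_bigr => i _ do rewrite hornerD hornerN hornerZ mulrBr mulrCA.
  by rewrite sumrB -mulr_sumr base // mulr0 subr0.
by move=> g; exact: main.
Qed.

Definition node_prod (P : pred T) i : R := \prod_(j | P j) (s i - s j).

(* The weights are the residues of [1 / prod_j (x - s j)]. *)
Lemma weight_residue p i j :
  (forall k, (k.+1 < #|T|)%N -> \sum_i p i * betaR (s i + k%:R) beta = 0) ->
  weight #|T|.-2 p i * node_prod (predC1 i) i = weight #|T|.-2 p j * node_prod (predC1 j) j.
Proof.
move=> H; have [->//|ij] := eqVneq i j.
have T2 : (2 <= #|T|)%N.
  by have := max_card [set i; j]%SET; rewrite cards2 ij.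
(* This test polynomial has degree |T| - 2 and vanishes at all nodes but two, so orthogonality
   leaves only the terms of i and j. *)
pose g := \prod_(l | (l != i) && (l != j)) ('X - (s l)%:P).
have sg : (size g <= #|T|.-2.+1)%N.
  rewrite (_ : g = \prod_(x <- [seq s l | l <- enum [pred l | (l != i) && (l != j)]])
      ('X - x%:P)); last by rewrite big_map big_enum.
  rewrite size_prod_XsubC size_map -cardE.
  have := cardC (pred2 i j); rewrite card2 ij /= => <-.
  rewrite add2n /= ltnS; apply: subset_leq_card; apply/fintype.subsetP => l.
  by rewrite !inE negb_or.
have := @weight_ortho #|T|.-2 p _ g sg.
have H' k : (k <= #|T|.-2)%N -> \sum_i p i * betaR (s i + k%:R) beta = 0.
  by move=> kT; apply: H; lia.
move/(_ H'); rewrite (bigD1 i) //= (bigD1 j) 1?eq_sym //= big1 ?addr0; last first.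
  move=> l /andP[li lj]; rewrite /g horner_prod (bigD1 l) ?li ?lj //=.
  by rewrite hornerXsubC subrr mul0r mulr0.
have -> : node_prod (predC1 i) i = (s i - s j) * g.[s i].
  rewrite /node_prod (bigD1 j) /=; last by rewrite eq_sym.
  by congr (_ * _); rewrite horner_prod; apply: eq_bigr => l _; rewrite hornerXsubC.
have -> : node_prod (predC1 j) j = (s j - s i) * g.[s j].
  rewrite /node_prod (bigD1 i) //=; congr (_ * _); rewrite horner_prod.
  by apply: eq_big => [l|l _]; rewrite 1?andbC // hornerXsubC.
move: (weight _ _ _) (weight _ _ _) (g.[_]) (g.[_]) => x y u v; set si := s i; set sj := s j.
move=> e; apply/eqP; rewrite -subr_eq0 -(mulr0 (si - sj)) -e; apply/eqP; ring.
Qed.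

Lemma node_prod_neq0 i : node_prod (predC1 i) i != 0.
Proof.
apply/prodf_neq0 => j ji; rewrite subr_eq0; apply: contraNneq ji => /s_inj ->.
by rewrite /= eqxx.
Qed.

(** One more vanishing moment admits a test polynomial of degree |T| - 1, which vanishes at all
    nodes but one and isolates a single weight. *)
Lemma moments_inj p : (forall k, (k < #|T|)%N -> \sum_i p i * betaR (s i + k%:R) beta = 0) ->
  forall i, p i = 0.
Proof.
move=> H i; have T0 : (0 < #|T|)%N by apply/card_gt0P; exists i.
apply: (@weight_eq0 #|T|.-1).
pose g := \prod_(l | l != i) ('X - (s l)%:P).
have sg : (size g <= #|T|.-1.+1)%N.
  rewrite (_ : g = \prod_(x <- [seq s l | l <- enum [pred l | l != i]]) ('X - x%:P));
      last by rewrite big_map big_enum.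
  rewrite size_prod_XsubC size_map -cardE.
  by have := cardC1 i => /= ->.
have H' k : (k <= #|T|.-1)%N -> \sum_i p i * betaR (s i + k%:R) beta = 0.
  by move=> kT; apply: H; lia.
have := weight_ortho H' sg.
rewrite (bigD1 i) //= big1 ?addr0; last first.
  move=> l li; rewrite /g horner_prod (bigD1 l) //=.
  by rewrite hornerXsubC subrr mul0r mulr0.
move/eqP; rewrite mulf_eq0 => /orP[/eqP //|].
have -> : g.[s i] = node_prod (predC1 i) i.
  by rewrite horner_prod; apply: eq_bigr => l _; rewrite hornerXsubC.
by rewrite (negPf (node_prod_neq0 i)).
Qed.

(** A square linear system, invertible by [moments_inj]. *)
Lemma moments_exist (m : nat -> R) :
  exists p, forall k, (k < #|T|)%N -> \sum_i p i * betaR (s i + k%:R) beta = m k.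
Proof.
pose A : 'M[R]_(#|T|) := \matrix_(i, k) betaR (s (enum_val i) + k%:R) beta.
have E (v : 'rV[R]_(#|T|)) (k : 'I_#|T|) : (v *m A) 0 k =
    \sum_i v 0 (enum_rank i) * betaR (s i + k%:R) beta.
  rewrite mxE (reindex enum_rank) /=; last by exists enum_val => i _;
      rewrite ?enum_rankK ?enum_valK.
  by apply: eq_bigr => i _; rewrite mxE enum_rankK.
have Au : A \in unitmx.
  rewrite -row_free_unit -kermx_eq0; apply/rowV0P => v /sub_kermxP vA.
  apply/rowP => i; rewrite mxE -(enum_valK i).
  apply: (@moments_inj (fun i => v 0 (enum_rank i))) => k kT.
  by rewrite -(E v (Ordinal kT)) vA mxE.
pose v := (\row_(k < #|T|) m k) *m invmx A.
exists (fun i => v 0 (enum_rank i)) => k kT.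
by rewrite -(E v (Ordinal kT)) mulmxKV // mxE.
Qed.

End Nodes.

(** * Type I Jacobi-Piñeiro polynomials *)

Section TypeI.
Variables (R : realType) (r : nat) (alpha : 'I_r -> R) (beta : R) (n : 'I_r -> nat).
Hypotheses (beta_gt : -1 < beta) (alpha_gt : forall j, -1 < alpha j).
Hypothesis alpha_int : forall j k, j != k -> alpha j - alpha k \isn't a Num.int.
Hypothesis n_gt0 : forall j, (0 < n j)%N.

(** One index for each coefficient of each component: the pair (j, m) stands for the power
    x^(alpha_j + m). *)
Let T : finType := {j : 'I_r & 'I_(n j)}.

Let node (i : T) : R := alpha (tag i) + (tagged i)%:R.

Let node_gt i : -1 < node i.
Proof. by rewrite ltr_wpDr. Qed.

Let node_inj : injective node.
Proof.
move=> [j a] [k b]; rewrite /node /= => e.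
have jk : j = k.
  apply/eqP; apply: contraT => /alpha_int /negP[].
  have -> : alpha j - alpha k = b%:R - a%:R by lra.
  by rewrite rpredB // intr_nat.
move: a b e; rewrite jk => a b e; have : a%:R = b%:R :> R by lra.
by move=> /eqP; rewrite eqr_nat => /eqP /val_inj ->.
Qed.

Let card_T : #|T| = mi_norm n.
Proof.
rewrite card_tagged sumnE big_map big_enum /mi_norm /=.
by apply: eq_bigr => j _; rewrite card_ord.
Qed.

Let coefs (P : 'I_r -> {poly R}) (i : T) : R := (P (tag i))`_(tagged i).

Let momentE (P : 'I_r -> {poly R}) k : (forall j, (size (P j) <= n j)%N) ->
  jp_moment alpha beta P k = (\sum_i coefs P i * betaR (node i + k%:R) beta)%:E.
Proof.
move=> sP; rewrite (jp_momentE k alpha_gt beta_gt sP); congr (_%:E).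
by rewrite (sig_big_dep _ _ (fun j (m : 'I_(n j)) =>
    (P j)`_m * betaR (alpha j + m%:R + k%:R) beta)).
Qed.

Lemma is_jp_typeI_exists : (0 < r)%N -> exists P, is_jp_typeI alpha beta n P.
Proof.
move=> r0.
have [p pE] := moments_exist node_gt node_inj beta_gt (fun k => (k.+1 == #|T|)%:R).
(* The default 0 is never reached: only indices m < n_j occur in the polynomial, and [insub]
   succeeds on them. *)
pose P (j : 'I_r) : {poly R} := \poly_(m < n j) oapp (fun a : 'I_(n j) => p (Tagged (fun j =>
    'I_(n j)) a)) 0 (insub m).
have sP j : (size (P j) <= n j)%N by exact: size_poly.
have cP i : coefs P i = p i.
  by case: i => j a; rewrite /coefs /= coef_poly ltn_ord valK.
have mP k : (k < #|T|)%N -> jp_moment alpha beta P k = ((k.+1 == #|T|)%:R)%:E.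
  move=> kT; rewrite momentE // -pE //; congr (_%:E).
  by apply: eq_bigr => i _; rewrite cP.
have T0 : (0 < #|T|)%N.
  by apply/card_gt0P; exists (Tagged (fun j => 'I_(n j)) (Ordinal (n_gt0 (Ordinal r0)))).
exists P; split=> // [k kn|].
  by rewrite -card_T in kn; rewrite mP ?(ltnW kn) // ltn_eqF.
by rewrite -card_T mP ?prednK // eqxx.
Qed.

Lemma jp_typeIP : (0 < r)%N -> is_jp_typeI alpha beta n (jp_typeI alpha beta n).
Proof. by move=> r0; apply: (@xgetPex _ _ [set P | is_jp_typeI alpha beta n P]%classic);
    exact: is_jp_typeI_exists. Qed.

Variables (P : 'I_r -> {poly R}) (i : 'I_r).
Hypothesis typeI_P : is_jp_typeI alpha beta n P.

Let N := (n i).-1.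
Let cc j := alpha i - alpha j + 1.

Let w := weight node beta #|T|.-2 (coefs P).

Let residue a b : w a * node_prod node (predC1 a) a = w b * node_prod node (predC1 b) b.
Proof.
have [sP mom0 _] := typeI_P.
apply: weight_residue => // k kT.
by have := mom0 k; rewrite -card_T momentE // => /(_ kT) [].
Qed.

(** By [residue] and the nonvanishing of the node products, one zero weight forces all weights to be
    zero, contrary to the last moment being 1. *)
Lemma typeI_coef0 : (P i)`_0 != 0.
Proof.
have [sP _ mom1] := typeI_P; apply/negP => /eqP P0.
pose t0 : T := Tagged (fun j => 'I_(n j)) (Ordinal (n_gt0 i)).
have w0 : w t0 = 0 by rewrite /w /weight /coefs /= P0 mul0r.
move: mom1; rewrite momentE // big1; last first.
  move=> t _; have := residue t t0; rewrite w0 mul0r => /eqP.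
  rewrite mulf_eq0 (negPf (node_prod_neq0 node_inj t)) orbF => /eqP.
  by move=> /(weight_eq0 node_gt beta_gt) ->; rewrite mul0r.
by move=> [] /eqP; rewrite eq_sym oner_eq0.
Qed.

(** The factors of the node product at alpha_i + m: [block j] collects the nodes alpha_j + l, and
    [self] the other nodes of component i. For m <= N, [self m] is (-1)^(N-m) m! (N-m)!. *)
Let block j (m : nat) : R := \prod_(l < n j) (alpha i + m%:R - (alpha j + l%:R)).
Let self (m : nat) : R := \prod_(l < n i | l != m :> nat) (m%:R - l%:R).

Let node_prodE (m : 'I_(n i)) :
  node_prod node (predC1 (Tagged (fun j => 'I_(n j)) m)) (Tagged (fun j => 'I_(n j)) m) =
  self m * \prod_(j | j != i) block j m.
Proof.
set t : T := Tagged _ m; rewrite /node_prod.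
pose Q j (l : 'I_(n j)) := (Tagged (fun j => 'I_(n j)) l : T) != t.
transitivity (\prod_(j | predT j) \prod_(l < n j | Q j l) (node t - (alpha j + l%:R))).
  rewrite (sig_big_dep predT Q (fun j (l : 'I_(n j)) => node t - (alpha j + l%:R))).
  by apply: eq_bigl => -[j l].
rewrite (bigD1 i) //=; congr (_ * _).
  rewrite /self; apply: eq_big => [l|l _].
    by rewrite /Q /t eq_Tagged.
  by rewrite /node /=; ring.
apply: eq_bigr => j ji; apply: eq_bigl => l; rewrite /Q; apply/negP => /eqP e.
by move: ji; rewrite (congr1 tag e : j = i) eqxx.
Qed.

(** Raising m by one shifts the factors by one place, so that only the two end factors differ. *)
Let blockS j m : block j m.+1 * (cc j - (n j)%:R + m%:R) = (cc j + m%:R) * block j m.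
Proof.
rewrite /block /cc; case: (n j) => [|k]; first by rewrite !big_ord0; ring.
rewrite big_ord_recl big_ord_recr /=.
have -> : \prod_(l < k) (alpha i + m.+1%:R - (alpha j + (bump 0 l)%:R)) =
    \prod_(l < k) (alpha i + m%:R - (alpha j + l%:R)).
  by apply: eq_bigr => l _; rewrite /bump leq0n add1n -!natr1; ring.
by rewrite -!natr1; ring.
Qed.

Let selfS m : (m < N)%N -> self m.+1 * (N%:R - m%:R) = - (m.+1%:R * self m).
Proof.
move=> mN; rewrite /self; have -> : n i = N.+1 by rewrite prednK.
rewrite big_mkcond [in RHS]big_mkcond big_ord_recl big_ord_recr /=.
rewrite (gtn_eqF mN).
have -> : \prod_(l < N) (if bump 0 l != m.+1 then m.+1%:R - (bump 0 l)%:R else 1) =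
    \prod_(l < N) (if l != m :> nat then m%:R - l%:R else 1) :> R.
  by apply: eq_bigr => l _; rewrite /bump leq0n add1n eqSS -!natr1 opprD addrACA subrr addr0.
by rewrite subr0 /=; ring.
Qed.

(** The residue identity between the nodes alpha_i + m and alpha_i + m + 1, cleared of denominators:
    [betaR_Sl] supplies the ratio of the beta integrals, [selfS] and [blockS] that of the node
    products. The outcome is the coefficient recursion of the hypergeometric series for P_i. *)
Lemma typeI_coefS m : (m.+1 < n i)%N ->
  (P i)`_m.+1 * (m.+1%:R * (alpha i + 1 + m%:R) * \prod_(j | j != i) (cc j + m%:R)) =
  (P i)`_m * ((m%:R - N%:R) * (alpha i + beta + (mi_norm n)%:R + m%:R) *
     \prod_(j | j != i) (cc j - (n j)%:R + m%:R)).
Proof.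
move=> mn; have mn' := ltnW mn.
have mN : (m < N)%N by rewrite -ltnS prednK.
have := residue (Tagged (fun j => 'I_(n j)) (Ordinal mn)) (Tagged (fun j =>
    'I_(n j)) (Ordinal mn')).
have F0 := node_prod_neq0 node_inj (Tagged (fun j => 'I_(n j)) (Ordinal mn')).
move: F0; rewrite !node_prodE /w /weight /coefs /node /=.
have nT : (2 <= #|T|)%N.
  rewrite card_T /mi_norm (bigD1 i) //=; lia.
have b1 : -1 < beta + (#|T|.-2)%:R by rewrite ltr_wpDr.
have a1 : -1 < alpha i + m%:R by rewrite ltr_wpDr.
rewrite -natr1 addrA betaR_Sl //.
have := betaR_gt0 a1 b1.
(* The weights use K = |n| - 2, and the 2 in [betaR_Sl] restores |n|. *)
have -> : alpha i + m%:R + (beta + (#|T|.-2)%:R) + 2 = alpha i + beta + (mi_norm n)%:R + m%:R.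
  rewrite -card_T; have -> : (#|T|%:R : R) =
      (#|T|.-2)%:R + 2 by case: (#|T|) nT => [|[|k]] // _; rewrite -natrD addn2.
  ring.
have A0 : alpha i + beta + (mi_norm n)%:R + m%:R != 0.
  apply: lt0r_neq0; rewrite -card_T; have : 2 <= #|T|%:R :> R by rewrite ler_nat.
  by have := @ler0n R m; have := alpha_gt i; have := beta_gt; lra.
have sS := selfS mN; rewrite -natr1 in sS.
have bS : \prod_(j | j != i) block j m.+1 * \prod_(j | j != i) (cc j - (n j)%:R + m%:R) =
    \prod_(j | j != i) (cc j + m%:R) * \prod_(j | j != i) block j m.
  by rewrite -!big_split /=; apply: eq_bigr => j _; exact: blockS.
move: sS bS A0; set A := alpha i + beta + _ + _; set B := betaR _ _.
set X1 := \prod_(_ | _) block _ m.+1; set X0 := \prod_(_ | _) block _ m.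
set Y := \prod_(_ | _) (_ - _ + _); set Z := \prod_(_ | _) (_ + _).
move: (self m.+1) (self m) => S1 S0 sS bS A0 B0 F0 E.
have B0' : B != 0 by rewrite gt_eqF.
apply: (mulIf (mulf_neq0 F0 B0')).
set u := (P i)`_m.+1 in E *; set v := (P i)`_m in E *.
transitivity (- (u * (alpha i + 1 + m%:R) * (S1 * (N%:R - m%:R)) * (X1 * Y) * B)).
  by rewrite sS bS; ring.
have E' : u * (alpha i + 1 + m%:R) * B * (S1 * X1) = v * A * B * (S0 * X0).
  have := congr1 (fun z => A * z) E.
  have -> : A * (u * ((alpha i + m%:R + 1) / A * B) * (S1 * X1)) =
      u * (alpha i + 1 + m%:R) * B * (S1 * X1).
    by field.
  by move=> ->; ring.
transitivity (- ((N%:R - m%:R) * Y * (u * (alpha i + 1 + m%:R) * B * (S1 * X1)))); first by ring.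
by rewrite E'; ring.
Qed.

End TypeI.

(** * Identification of the type I components with multiplied Jacobi polynomials *)

Section Shape.
Variable R : realType.
Implicit Types (p q : {poly R}) (N : nat) (a b c d t : R).

Lemma coef_jacobiS N c d m : 0 < c -> (m < N)%N ->
  (jacobi N c d)`_m.+1 * (m.+1%:R * (c + m%:R)) =
  (jacobi N c d)`_m * ((m%:R - N%:R) * (c + d + N%:R - 1 + m%:R)).
Proof.
move=> c0 mN; rewrite !coef_poly !ltnS mN (ltnW mN) !pochS exprS.
have := congr1 (fun k => k%:R : R) (mul_bin_left N m); rewrite /= !natrM natrB ?(ltnW mN) // => E.
have cm : c + m%:R != 0 by rewrite gt_eqF // ltr_wpDr.
have := poch_neq0 m c0; move: (poch (c + d + _ - 1) m) (poch c m) => P Q Q0.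
move: E; move: ('C(N, m.+1)%:R : R) ('C(N, m)%:R : R) (m.+1%:R : R) => C1 C0 k1 E.
transitivity (- ((-1) ^+ m * (k1 * C1) * (P * (c + d + N%:R - 1 + m%:R)) / Q)).
  by field; rewrite cm Q0.
by rewrite E; field.
Qed.

Lemma poch_weightS N a b m : 0 < a -> 0 < b -> (m < N)%N ->
  poch_weight N a b m.+1 * (a + m%:R) = poch_weight N a b m * (b + N%:R - m%:R - 1).
Proof.
move=> a0 b0 mN; rewrite /poch_weight pochS.
have -> : (N - m = (N - m.+1).+1)%N by lia.
rewrite pochS.
have -> : (N - m.+1)%:R = N%:R - m%:R - 1 :> R by rewrite natrB // -natr1; ring.
have am : a + m%:R != 0 by rewrite gt_eqF // ltr_wpDr.
have bm : b + (N%:R - m%:R - 1) != 0.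
  by rewrite gt_eqF // ltr_wpDr // -addrA -opprD natr1 subr_ge0 ler_nat.
have := poch_neq0 m a0; have := poch_neq0 (N - m.+1) b0.
move: (poch a _) (poch b _) => P Q Q0 P0.
by field; rewrite am bm P0 Q0.
Qed.

(** For p of degree at most N, this is p(-x). *)
Definition flip N p : {poly R} := coef_mul N (fun m => (-1) ^+ m) p.

(** The pairs (c_j, d_j) for j <> i. *)
Definition params r (alpha : 'I_r -> R) (n : 'I_r -> nat) (i : 'I_r) : seq (R * R) :=
  [seq (alpha i - alpha j + 1, alpha j + (n j)%:R - (n i)%:R + 1 - alpha i)
     | j <- enum 'I_r & j != i].

Lemma coef_pineiro N c d l m : (m <= N)%N ->
  (pineiro N c d l)`_m = \prod_(y <- l) poch_weight N y.1 y.2 m * (jacobi N c d)`_m.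
Proof. by move=> mN; rewrite coef_coef_mul ?size_jacobi. Qed.

(** Both sides satisfy the same two-term recursion, with a nonzero factor on the higher coefficient,
    and have nonzero constant terms. Each of the r - 1 weights brings a factor -1 into the ratio of
    consecutive coefficients; this replaces x by (-1)^(r-1) x, which is a [flip] when r is even. *)
Lemma typeI_shape r (alpha : 'I_r -> R) (beta : R) (n : 'I_r -> nat) (i : 'I_r) :
  -1 < beta -> (forall j, -1 < alpha j) ->
  (forall j k, j != k -> alpha j - alpha k \isn't a Num.int) ->
  (forall j, (0 < n j)%N) ->
  (forall y, y \in params alpha n i -> 0 < y.1 /\ 0 < y.2) ->
  exists2 k : R, k != 0 & jp_typeI alpha beta n i =
    k *: (if odd r then id else flip (n i).-1)
      (pineiro (n i).-1 (alpha i + 1) (beta + (mi_norm n)%:R - (n i)%:R + 1) (params alpha n i)).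
Proof.
move=> b1 a1 aint n0 lpos; have r0 : (0 < r)%N := leq_ltn_trans (leq0n i) (ltn_ord i).
have typeI := jp_typeIP b1 a1 aint n0 r0.
have [sP _ _] := typeI.
have P0 := typeI_coef0 b1 a1 aint n0 i typeI.
have PS := @typeI_coefS R r alpha beta n b1 a1 aint n0 _ i typeI.
move: (jp_typeI alpha beta n) sP P0 PS {typeI} => P /(_ i) sP P0 PS.
set N := (n i).-1; set c := alpha i + 1; set d := _ + 1; set H := pineiro _ _ _ _.
have nN : n i = N.+1 by rewrite prednK.
have c0 : 0 < c by rewrite -ltrBlDr sub0r.
(* [q] is the substitution x -> (-1)^(r-1) x in [H], which treats both parities at once. *)
pose q := coef_mul N (fun m => ((-1) ^+ r.-1) ^+ m) H.
have sH : (size H <= N.+1)%N by exact: size_coef_mul.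
have -> : (if odd r then id else flip N) H = q.
  apply/polyP => m; rewrite /q /flip coef_coef_mul // -(signr_odd _ r.-1).
  have -> : odd r.-1 = ~~ odd r by case: (r) r0 => //= k; rewrite negbK.
  by case: (odd r); rewrite ?expr0 ?expr1n ?mul1r ?expr1 // coef_coef_mul.
pose W m : R := \prod_(j | j != i) poch_weight N (alpha i - alpha j + 1) (alpha j + (n j)%:R -
    (n i)%:R + 1 - alpha i) m.
have qE m : (m <= N)%N -> q`_m = ((-1) ^+ r.-1) ^+ m * (W m * (jacobi N c d)`_m).
  move=> mN; rewrite coef_coef_mul // coef_pineiro // /W big_map big_filter.
  by rewrite big_enum_cond /=; congr (_ * (_ * _)); apply: eq_bigl.
have lpos' j : j != i -> 0 < alpha i - alpha j + 1 /\
    0 < alpha j + (n j)%:R - (n i)%:R + 1 - alpha i.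
  move=> ji; apply: (lpos (_, _)); apply/mapP; exists j => //.
  by rewrite mem_filter ji mem_enum.
have J0 : (jacobi N c d)`_0 != 0.
  by rewrite coef_poly /= bin0 !poch0 expr0 !mul1r invr1 oner_neq0.
have W0 m : W m != 0.
  apply/prodf_neq0 => j ji; have [h1 h2] := lpos' j ji.
  by rewrite invr_eq0 mulf_neq0 // poch_neq0.
have q0 : q`_0 != 0 by rewrite qE // expr0 mul1r mulf_neq0.
pose Z m : R := \prod_(j | j != i) (alpha i - alpha j + 1 + m%:R).
pose Y m : R := \prod_(j | j != i) (alpha i - alpha j + 1 - (n j)%:R + m%:R).
have WS m : (m < N)%N -> W m.+1 * Z m = W m * ((-1) ^+ r.-1 * Y m).
  move=> mN; have -> : (-1) ^+ r.-1 = \prod_(j | j != i) (-1) :> R.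
    rewrite prodr_const; congr (_ ^+ _); have := cardC1 i; rewrite card_ord => <-.
    exact: eq_card.
  rewrite /W /Z /Y -!big_split /=; apply: eq_bigr => j ji.
  have [h1 h2] := lpos' j ji; rewrite poch_weightS // nN -natr1; congr (_ * _); ring.
have qS m : (m < N)%N ->
    q`_m.+1 * (m.+1%:R * (c + m%:R) * Z m) =
    q`_m * ((m%:R - N%:R) * (alpha i + beta + (mi_norm n)%:R + m%:R) * Y m).
  move=> mN; rewrite !qE // ?(ltnW mN) // exprS.
  have JS := coef_jacobiS d c0 mN; have := WS m mN.
  have -> : alpha i + beta + (mi_norm n)%:R = c + d + N%:R - 1.
    by rewrite /c /d nN -natr1; ring.
  have : (-1) ^+ r.-1 * (-1) ^+ r.-1 = 1 :> R by rewrite -expr2 sqrr_sign.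
  move: JS; set J1 := (jacobi _ _ _)`_m.+1; set J2 := (jacobi _ _ _)`_m.
  move: (W m.+1) (W m) (Z m) (Y m) => W1 W2 z y.
  move: ((-1) ^+ r.-1) => sg JS sg2 WSm.
  transitivity (sg * sg ^+ m * (W1 * z) * (J1 * (m.+1%:R * (c + m%:R)))); first by ring.
  rewrite JS WSm; transitivity ((sg * sg) * sg ^+ m * W2 * y * (J2 * ((m%:R - N%:R) *
      (c + d + N%:R - 1 + m%:R)))); first by ring.
  by rewrite sg2; ring.
pose k := (P i)`_0 / q`_0; exists k; first by rewrite mulf_neq0 ?invr_eq0.
have E m : (m <= N)%N -> (P i)`_m = k * q`_m.
  elim: m => [|m IH] mN; first by rewrite mulfVK.
  have := PS m; rewrite nN ltnS => /(_ mN); rewrite IH ?(ltnW mN) //.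
  rewrite -/c -/(Z m) -/(Y m) -/N -(mulrA k) -(qS m mN) mulrA.
  have D0 : m.+1%:R * (c + m%:R) * Z m != 0.
    rewrite !mulf_neq0 ?pnatr_eq0 // ?(gt_eqF (ltr_wpDr _ c0)) //.
    by apply/prodf_neq0 => j ji; have [h1 _] := lpos' j ji; rewrite gt_eqF // ltr_wpDr.
  exact: mulIf.
apply/polyP => m; rewrite coefZ; case: (leqP m N) => mN; first exact: E.
rewrite [q`_m]nth_default ?mulr0; last by rewrite (leq_trans (size_coef_mul _ _ _)).
by rewrite nth_default // (leq_trans sP) // nN.
Qed.

End Shape.

(** * From enumerated positive zeros to ordered zeros, interlacing and complex zeros *)

Section Zeros.
Variable R : realType.
Implicit Types (p q : {poly R}) (N : nat) (a b c d t : R).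

Lemma ordered_zerosZ a p s : a != 0 -> ordered_zeros p s -> ordered_zeros (a *: p) s.
Proof.
move=> a0 [p0 ss pE]; split=> //; first by rewrite scaler_eq0 (negPf a0).
by rewrite lead_coefZ -scalerA -pE.
Qed.

Lemma ordered_zeros_mkseq N p (a : R) (s : nat -> R) : a != 0 -> p = a *: prodX N s ->
  (forall i, (i.+1 < N)%N -> s i <= s i.+1) -> ordered_zeros p (mkseq s N).
Proof.
move=> a0 pE sl; split.
- by rewrite pE scaler_eq0 (negPf a0) monic_neq0 // prodX_monic.
- apply/(sortedP 0) => i; rewrite size_mkseq => iN; rewrite !nth_mkseq ?(ltnW iN) //.
  exact: sl.
- by rewrite -prodX_seq {1}pE pE lead_coefZ (monicP (prodX_monic _ _)) mulr1.
Qed.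

Lemma ordered_zeros_pos_zeros N p s : pos_zeros N p s -> ordered_zeros p (mkseq s N).
Proof.
move=> [p0 pE sl _]; apply: (ordered_zeros_mkseq _ pE); first by rewrite lead_coef_eq0.
by move=> i iN; apply: sl.
Qed.

Lemma ordered_zeros_flip N p s : pos_zeros N p s ->
  ordered_zeros (flip N p) (mkseq (fun i => - s (N - i.+1)%N) N).
Proof.
move=> ps; have sp := pos_zeros_size ps; have [p0 pE sl _] := ps.
apply: (@ordered_zeros_mkseq _ _ (lead_coef p * (-1) ^+ N)).
- by rewrite mulf_neq0 ?lead_coef_eq0 ?signr_eq0.
- apply: poly_horner_inj => x _; rewrite coef_mul_exp_horner ?sp // {1}pE !hornerZ -mulrA.
  congr (_ * _); rewrite !horner_prodX -[in (-1) ^+ N](card_ord N) -prodr_const.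
  rewrite (reindex_inj rev_ord_inj) -big_split /=; apply: eq_bigr => i _.
  by ring.
- by move=> i iN; rewrite lerN2 sl //; lia.
Qed.

Lemma interlacesZ a b p q : a != 0 -> b != 0 -> interlaces p q -> interlaces (a *: p) (b *: q).
Proof.
by move=> a0 b0 [s [t [ps qt st h1 h2]]]; exists s, t; split=> //; exact: ordered_zerosZ.
Qed.

Lemma interlaces_zeros_le N p q : zeros_le true N p q -> interlaces p q.
Proof.
move=> [s [t [ps qt st /(_ isT) ts]]]; exists (mkseq s N), (mkseq t N).
split; rewrite ?size_mkseq //; try exact: ordered_zeros_pos_zeros.
- by move=> k kN; rewrite !nth_mkseq // st.
- by move=> k kN; rewrite !nth_mkseq ?(ltnW kN) // ts.
Qed.

(** Negation reverses the order of the zeros; this exchange of roles is the source of the dependence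
    on the parity of r. *)
Lemma interlaces_flip N p q : zeros_le true N p q -> interlaces (flip N q) (flip N p).
Proof.
move=> [s [t [ps qt st /(_ isT) ts]]].
exists (mkseq (fun i => - t (N - i.+1)%N) N), (mkseq (fun i => - s (N - i.+1)%N) N).
split; rewrite ?size_mkseq //; try exact: ordered_zeros_flip.
- by move=> k kN; rewrite !nth_mkseq // lerN2 st //; lia.
- move=> k kN; rewrite !nth_mkseq ?(ltnW kN) // lerN2.
  have -> : (N - k.+1 = (N - k.+2).+1)%N by lia.
  by apply: ts; lia.
Qed.

Lemma polys_zeros_in_ordered m (K : set R) p s : ordered_zeros p s -> (size s <= m)%N ->
  {in s, forall x, K x} -> polys_zeros_in m K p.
Proof.
move=> [p0 _ pE] sm sK; split.
  by rewrite pE size_scale ?lead_coef_eq0 // size_prod_XsubC ltnS.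
move=> z; rewrite pE map_polyZ rootZ ?fmorph_eq0 ?lead_coef_eq0 //.
rewrite rmorph_prod /=; under eq_bigr do rewrite map_polyXsubC.
rewrite -(big_map (real_complex R) xpredT (fun y => 'X - y%:P)) root_prod_XsubC.
by move=> /mapP[x xs ->]; exists x => //; exact: sK.
Qed.

Lemma mem_params r (alpha : 'I_r -> R) n i y : y \in params alpha n i ->
  exists j, y = (alpha i - alpha j + 1, alpha j + (n j)%:R - (n i)%:R + 1 - alpha i).
Proof. by move=> /mapP[j _ ->]; exists j. Qed.

Lemma size_params r (alpha : 'I_r -> R) n i : size (params alpha n i) = r.-1.
Proof.
rewrite size_map size_filter; have := cardC1 i; rewrite card_ord => <-.
by rewrite -sum1_count big_enum_cond sum1_card; apply: eq_card => j; rewrite !inE.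
Qed.

End Zeros.

Theorem theorem4p1 (R : realType) (r : nat) (hr : (0 < r)%N)
  (beta : R) (hbeta : -1 < beta)
  (alpha : 'I_r -> R)
  (halpha_dec : forall j k : 'I_r, (j < k)%N -> alpha k < alpha j)
  (halpha_gt : forall j : 'I_r, -1 < alpha j)
  (halpha_int : forall j k : 'I_r, j != k ->
     alpha j - alpha k \isn't a Num.int)
  (n : 'I_r -> nat) (hn : forall j : 'I_r, (0 < n j)%N)
  (i : 'I_r)
  (hi_lo : alpha (Ordinal hr) - 1 < alpha i)
  (hi_hi : alpha i <
     (\big[Num.min/(alpha (Ordinal hr) + (n (Ordinal hr))%:R)]_(j < r)
        (alpha j + (n j)%:R)) - (n i)%:R + 1) :
  polys_zeros_in (n i).-1 (Delta r) (jp_typeI alpha beta n i) /\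
  (forall t : R, 0 < t -> t <= 2 ->
    (~~ odd r ->
      interlaces (jp_typeI (shift_params alpha t) beta n i) (jp_typeI alpha beta n i) /\
      interlaces (jp_typeI alpha beta n i) (jp_typeI alpha (beta + t) n i)) /\
    (odd r ->
      interlaces (jp_typeI alpha beta n i) (jp_typeI (shift_params alpha t) beta n i) /\
      interlaces (jp_typeI alpha (beta + t) n i) (jp_typeI alpha beta n i))).
Proof.
have alpha1 j : alpha j <= alpha (Ordinal hr).
  have [j0|j0] := posnP j; last by apply/ltW/halpha_dec.
  by rewrite le_eqVlt; apply/orP; left; apply/eqP; congr alpha; exact: val_inj.
have minP j : alpha i < alpha j + (n j)%:R - (n i)%:R + 1.
  by apply: (lt_le_trans hi_hi); rewrite !lerD2r bigmin_le_cond.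
(* [alpha1] and [hi_lo] give c_j > 0, and [minP] gives d_j > 0. *)
have lpos y : y \in params alpha n i -> 0 < y.1 /\ 0 < y.2.
  move=> /mem_params [j ->] /=; have := alpha1 j; have := minP j.
  by move: hi_lo => *; split; lra.
have shape (b : R) (b1 : -1 < b) := typeI_shape b1 halpha_gt halpha_int hn lpos.
(* The pairs in [params] involve only differences of the alpha_j, so a common shift by t acts on c
   alone. *)
have shapeS (t : R) : 0 < t -> exists2 k : R, k != 0 & jp_typeI (shift_params alpha t) beta n i =
    k *: (if odd r then id else flip (n i).-1)
      (pineiro (n i).-1 (alpha i + 1 + t) (beta + (mi_norm n)%:R - (n i)%:R + 1)
          (params alpha n i)).
  move=> t0; have pE : params (shift_params alpha t) n i = params alpha n i.
    apply: eq_map => j; rewrite /shift_params; congr (_, _); ring.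
  have aS j : -1 < shift_params alpha t j by rewrite /shift_params; have := halpha_gt j; lra.
  have aI j k : j != k -> shift_params alpha t j - shift_params alpha t k \isn't a Num.int.
    move=> /halpha_int; congr (~~ (_ \is a Num.int)).
    by rewrite /shift_params; ring.
  have lS y : y \in params (shift_params alpha t) n i -> 0 < y.1 /\ 0 < y.2.
    by rewrite pE; exact: lpos.
  have [k k0 kE] := typeI_shape hbeta aS aI hn lS.
  exists k => //; rewrite kE pE.
  by have -> : alpha i + 1 + t = shift_params alpha t i + 1 by rewrite /shift_params; ring.
set N := (n i).-1; set c := alpha i + 1; pose dd (b : R) := b + (mi_norm n)%:R - (n i)%:R + 1.
have c0 : 0 < c by rewrite /c; have := halpha_gt i; lra.
have d0 b : -1 < b -> 0 < dd b.
  move=> b1; rewrite /dd; have : (n i)%:R <= (mi_norm n)%:R :> R.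
    by rewrite ler_nat /mi_norm (bigD1 i) //= leq_addr.
  by lra.
have [k0 k00 E0] := shape _ hbeta.
split.
  have zK (z : seq R) : ordered_zeros (jp_typeI alpha beta n i) z -> size z = N ->
      {in z, forall x, Delta r x} -> polys_zeros_in N (Delta r) (jp_typeI alpha beta n i).
    by move=> oz sz zD; apply: (polys_zeros_in_ordered oz) => //; rewrite sz.
  (* For r = 1 there is no multiplier, and the Jacobi polynomial itself has its zeros below 1. *)
  have [r1|r1] := eqVneq r 1%N.
    have pnil : params alpha n i = [::].
      by apply/size0nil; rewrite size_params r1.
    have [s ps s1] := jacobi_zeros_01 N c0 (d0 _ hbeta).
    have [_ _ _ s0] := ps.
    apply: (zK (mkseq s N)); rewrite ?size_mkseq //.
      have o1 : odd r by rewrite r1.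
      by rewrite E0 o1 pnil pineiro_nil; apply: ordered_zerosZ => //;
          exact: ordered_zeros_pos_zeros.
    move=> x /(nthP 0)[m]; rewrite size_mkseq => mN <-; rewrite nth_mkseq //.
    by rewrite /Delta r1 /= s0 // s1.
  (* The comparison of the polynomial with itself serves to produce its positive zeros. *)
  have [s [_ [ps _ _ _]]] : zeros_le false N (pineiro N c (dd beta) (params alpha n i))
      (pineiro N c (dd beta) (params alpha n i)).
    apply: zeros_le_pineiro => //; apply: zeros_le_jacobi; rewrite ?d0 //.
    by apply: zeros_le_mjacobi_le; rewrite ?d0.
  have [_ _ _ s0] := ps.
  case: (boolP (odd r)) => orr.
    apply: (zK (mkseq s N)); rewrite ?size_mkseq //.
      by rewrite E0 orr; apply: ordered_zerosZ => //; exact: ordered_zeros_pos_zeros.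
    move=> x /(nthP 0)[m]; rewrite size_mkseq => mN <-; rewrite nth_mkseq //.
    by rewrite /Delta (negPf r1) orr /= s0.
  apply: (zK (mkseq (fun i => - s (N - i.+1)%N) N)); rewrite ?size_mkseq //.
    by rewrite E0 (negPf orr); apply: ordered_zerosZ => //; exact: ordered_zeros_flip.
  move=> x /(nthP 0)[m]; rewrite size_mkseq => mN <-; rewrite nth_mkseq //.
  by rewrite /Delta (negPf r1) (negPf orr) /= oppr_lt0 s0 //; lia.
move=> t t0 t2.
have bt : -1 < beta + t by lra.
have [k1 k10 E1] := shape _ bt; have [k2 k20 E2] := shapeS _ t0.
have rc := zeros_le_pineiro_c N lpos c0 (d0 _ hbeta) t0 t2.
have rd := zeros_le_pineiro_d N lpos c0 (d0 _ hbeta) t0 t2.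
(* Adding t to beta adds t to d, which moves the zeros the opposite way from adding t to c. *)
have dE : dd beta + t = beta + t + (mi_norm n)%:R - (n i)%:R + 1 by rewrite /dd; ring.
rewrite dE in rd.
rewrite E0 E1 E2; split=> [/negPf orr | orr]; rewrite orr; split; apply: interlacesZ => //.
- exact: interlaces_flip rc.
- exact: interlaces_flip rd.
- exact: interlaces_zeros_le rc.
- exact: interlaces_zeros_le rd.
Qed.
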